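(* Let $\mathbf{k}$ be a field, let $R$ and $B$ be affine $\mathbf{k}$-domains, let $N\in\mathbb{N}$, let $R[X]=R[X_1,\dots,X_N]$ be a polynomial ring in $N$ variables over $R$, and let $\Psi:B\to R[X]$ be a homomorphism of $\mathbf{k}$-algebras. Then the following hold. (a) $\mathcal{X}_{\mathbf{k}}(\Psi)$ is a constructible subset of $\mathrm{Spec}\,R$. (b) If $B$ is geometrically integral and $\mathfrak{m}$ is a maximal ideal of $R$, then $\mathfrak{m}\in\mathcal{X}_{\mathbf{k}}(\Psi)$ if and only if $\Psi^{\mathfrak{m}}$ is injective.
   Context: Rings are commutative with unity, and $0\in\mathbb{N}$. An affine $\mathbf{k}$-domain is an integral domain that is a finitely generated $\mathbf{k}$-algebra. A $\mathbf{k}$-algebra $B$ is geometrically integral if $K\otimes_{\mathbf{k}}B$ is an integral domain for every extension field $K$ of $\mathbf{k}$. The field $\mathbf{k}$ is arbitrary. For $\mathfrak{p}\in\mathrm{Spec}\,R$ let $\kappa(\mathfrak{p})=R_{\mathfrak{p}}/\mathfrak{p}R_{\mathfrak{p}}$, and let $\tilde\varphi_{\mathfrak{p}}:R[X]\to\kappa(\mathfrak{p})[X]=\kappa(\mathfrak{p})[X_1,\dots,X_N]$ be the homomorphism that applies the canonical map $R\to\kappa(\mathfrak{p})$ to coefficients and fixes each $X_i$. Define $\Psi^{\mathfrak{p}}=\tilde\varphi_{\mathfrak{p}}\circ\Psi:B\to\kappa(\mathfrak{p})[X]$ and let $\hat\Psi^{\mathfrak{p}}:\kappa(\mathfrak{p})\otimes_{\mathbf{k}}B\to\kappa(\mathfrak{p})[X]$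 be the $\kappa(\mathfrak{p})$-homomorphism $\lambda\otimes b\mapsto\lambda\,\Psi^{\mathfrak{p}}(b)$. Finally, $$\mathcal{X}_{\mathbf{k}}(\Psi)=\{\mathfrak{p}\in\mathrm{Spec}\,R \mid \hat\Psi^{\mathfrak{p}}\text{ is injective}\}.$$ *)

(* Defs.v *)
From HB Require Import structures.
From mathcomp Require Import all_boot all_order all_algebra.
From mathcomp Require Import generic_quotient ring_quotient fraction mpoly.
From mathcomp Require Import boolp classical_sets topology_structure.

Set Implicit Arguments.
Unset Strict Implicit.
Unset Printing Implicit Defensive.

Import GRing.Theory.
Local Open Scope classical_set_scope.
Local Open Scope ring_scope.
Local Open Scope quotient_scope.

(* Throughout, a commutative k-algebra is a commutative ring A together with  *)
(* its structure morphism iA : {rmorphism k -> A}.                            *)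

Definition finitely_generated (k A : comNzRingType) (iA : {rmorphism k -> A}) :=
  exists (n : nat) (x : 'I_n -> A),
    forall b : A, exists P : {mpoly k[n]}, b = mmap iA x P.

Definition integral_domain (T : comPzRingType) :=
  (1 : T) != 0 /\ forall x y : T, x * y = 0 -> x = 0 \/ y = 0.

(* The tensor product A (x)_k B: formal finite sums of pairs, modulo the      *)
(* smallest congruence making (a, b) |-> a (x) b biadditive and k-balanced.   *)

Inductive tens_rel (k A B : comPzRingType)
    (iA : {rmorphism k -> A}) (iB : {rmorphism k -> B}) :
    seq (A * B) -> seq (A * B) -> Prop :=
| TRrefl s : tens_rel iA iB s s
| TRsym s t : tens_rel iA iB s t -> tens_rel iA iB t s
| TRtrans s t u :
    tens_rel iA iB s t -> tens_rel iA iB t u -> tens_rel iA iB s u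
| TRcat s s' t t' : tens_rel iA iB s s' -> tens_rel iA iB t t' ->
    tens_rel iA iB (s ++ t) (s' ++ t')
| TRcatC s t : tens_rel iA iB (s ++ t) (t ++ s)
| TRzero b : tens_rel iA iB [:: (0, b)] [::]
| TRaddl a a' b : tens_rel iA iB [:: (a + a', b)] [:: (a, b); (a', b)]
| TRaddr a b b' : tens_rel iA iB [:: (a, b + b')] [:: (a, b); (a, b')]
| TRbal a c b : tens_rel iA iB [:: (a * iA c, b)] [:: (a, iB c * b)].

Section Tensor.
Variables (k A B : comPzRingType).
Variables (iA : {rmorphism k -> A}) (iB : {rmorphism k -> B}).

Notation "s ~~> t" := (tens_rel iA iB s t) (at level 70).
Implicit Types s t u : seq (A * B).

Definition tens_eqb s t : bool := `[< s ~~> t >].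

Lemma tens_eqb_equiv : equiv_class_of tens_eqb.
Proof.
split=> [s|s t|t s u].
- by apply/asboolP; exact: TRrefl.
- by apply/asboolP/asboolP; exact: TRsym.
- by move=> /asboolP st /asboolP tu; apply/asboolP; exact: TRtrans tu.
Qed.
Canonical tens_eqb_equivRel := EquivRelPack tens_eqb_equiv.
Canonical tens_eqb_encModRel := defaultEncModRel tens_eqb.

Definition tensor := {eq_quot tens_eqb}.
HB.instance Definition _ : EqQuotient _ tens_eqb tensor :=
  EqQuotient.on tensor.
HB.instance Definition _ := Choice.on tensor.

Definition tens (a : A) (b : B) : tensor := \pi_tensor [:: (a, b)].

Lemma tensorP s t : s ~~> t <-> \pi_tensor s = \pi_tensor t.
Proof.
split=> [st|/eqP]; first by apply/eqP; rewrite eqmodE; apply/asboolP.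
by rewrite eqmodE => /asboolP.
Qed.

Lemma tensorW (Q : tensor -> Prop) :
  (forall s, Q (\pi_tensor s)) -> forall x, Q x.
Proof. exact: quotW. Qed.

Lemma tens_repr s : repr (\pi_tensor s) ~~> s.
Proof. by apply/tensorP; rewrite reprK. Qed.

Definition tens_mulp (p q : A * B) : A * B := (p.1 * q.1, p.2 * q.2).
Definition tens_opps s := [seq (- p.1, p.2) | p <- s].
Definition tens_muls s t := [seq tens_mulp p q | p <- s, q <- t].

Definition tens_zero : tensor := \pi_tensor [::].
Definition tens_one : tensor := \pi_tensor [:: (1, 1)].
Definition tens_add (x y : tensor) : tensor := \pi_tensor (repr x ++ repr y).
Definition tens_opp (x : tensor) : tensor := \pi_tensor (tens_opps (repr x)).
Definition tens_mul (x y : tensor) : tensor :=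
  \pi_tensor (tens_muls (repr x) (repr y)).

Lemma TRzeror a : [:: (a, 0)] ~~> [::].
Proof.
have := TRbal iA iB a 0 0; rewrite !rmorph0 mulr0 mul0r => /TRsym H.
exact: TRtrans H (TRzero _ _ _).
Qed.

Lemma TRperm s t : perm_eq s t -> s ~~> t.
Proof.
elim: s t => [|x s IH] t.
  by rewrite perm_sym => /perm_nilP ->; exact: TRrefl.
move=> st; have xt : x \in t by rewrite -(perm_mem st) mem_head.
case/splitPr: xt st => t1 t2.
rewrite -[x :: t2]cat1s perm_sym perm_catCA perm_cons perm_sym.
move=> /IH H; rewrite -[x :: s]cat1s catA.
apply: (TRtrans (t := [:: x] ++ (t1 ++ t2))); first by apply: TRcat H; apply: TRrefl.
by rewrite catA; apply: TRcat; [exact: TRcatC|exact: TRrefl].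
Qed.

Lemma tens_muls_catl s s' t :
  tens_muls (s ++ s') t = tens_muls s t ++ tens_muls s' t.
Proof. by rewrite /tens_muls allpairs_cat. Qed.

Lemma tens_muls_catr s t t' :
  tens_muls s (t ++ t') ~~> tens_muls s t ++ tens_muls s t'.
Proof. by apply: TRperm; apply/permPl; apply: perm_allpairs_catr. Qed.

Lemma tens_mulsC s t : tens_muls s t ~~> tens_muls t s.
Proof.
apply: TRperm; elim: s => [|p s IH]; first by rewrite /tens_muls allpairs0r.
rewrite perm_sym [perm_eq _ _](perm_allpairs_consr _ _ _ (fun=> s)) perm_sym /=.
rewrite [tens_muls (p :: s) t]allpairs_cons.
have -> : [seq tens_mulp x p | x <- t] = [seq tens_mulp p x | x <- t].
  by apply: eq_map => x; rewrite /tens_mulp mulrC [x.2 * _]mulrC.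
by rewrite perm_cat2l.
Qed.

Lemma tens_muls1r p s s' :
  s ~~> s' -> tens_muls [:: p] s ~~> tens_muls [:: p] s'.
Proof.
rewrite /tens_muls /= !cats0; elim=> {s s'}.
- by move=> s; exact: TRrefl.
- by move=> s t _; exact: TRsym.
- by move=> s t u _ H1 _; exact: TRtrans.
- by move=> s s' t t' _ H1 _ H2; rewrite !map_cat; exact: TRcat.
- by move=> s t; rewrite !map_cat; exact: TRcatC.
- by move=> b /=; rewrite /tens_mulp /= mulr0; exact: TRzero.
- by move=> a a' b /=; rewrite /tens_mulp /= mulrDr; exact: TRaddl.
- by move=> a b b' /=; rewrite /tens_mulp /= mulrDr; exact: TRaddr.
- move=> a c b /=; rewrite /tens_mulp /= mulrA [p.2 * (_ * _)]mulrCA.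
  exact: TRbal.
Qed.

Lemma tens_mulsr s t t' : t ~~> t' -> tens_muls s t ~~> tens_muls s t'.
Proof.
move=> tt'; elim: s => [|p s IH]; first exact: TRrefl.
rewrite -cat1s !tens_muls_catl; apply: TRcat => //; exact: tens_muls1r.
Qed.

Lemma tens_mulss s s' t t' :
  s ~~> s' -> t ~~> t' -> tens_muls s t ~~> tens_muls s' t'.
Proof.
move=> ss' tt'; apply: TRtrans (tens_mulsr _ tt') _.
apply: TRtrans (tens_mulsC _ _) _; apply: TRtrans (tens_mulsC _ _).
exact: tens_mulsr.
Qed.

Lemma tens_oppsE s : tens_opps s = tens_muls [:: (-1, 1)] s.
Proof.
rewrite /tens_muls /= cats0; apply: eq_map => p.
by rewrite /tens_mulp /= mulN1r mul1r.
Qed.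

Lemma tens_oppss s s' : s ~~> s' -> tens_opps s ~~> tens_opps s'.
Proof. by rewrite !tens_oppsE; exact: tens_muls1r. Qed.

Lemma tens_oppsN s : tens_opps s ++ s ~~> [::].
Proof.
elim: s => [|p s IH]; first exact: TRrefl.
apply: (TRtrans (t := ([:: (- p.1, p.2)] ++ [:: p]) ++ (tens_opps s ++ s))).
  apply: TRperm; rewrite /= perm_cons -[p :: s]cat1s perm_catCA /=.
  by rewrite perm_refl.
apply: (@TRtrans _ _ _ _ _ _ ([::] ++ [::])); last exact: TRrefl.
apply: TRcat => //; case: p => a b /=.
apply: TRtrans (TRzero iA iB b); rewrite -(addNr a); apply: TRsym.
exact: TRaddl.
Qed.

Lemma pi_tens_add s t :
  tens_add (\pi_tensor s) (\pi_tensor t) = \pi_tensor (s ++ t).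
Proof. by apply/tensorP/TRcat; exact: tens_repr. Qed.

Lemma pi_tens_opp s : tens_opp (\pi_tensor s) = \pi_tensor (tens_opps s).
Proof. by apply/tensorP/tens_oppss; exact: tens_repr. Qed.

Lemma pi_tens_mul s t :
  tens_mul (\pi_tensor s) (\pi_tensor t) = \pi_tensor (tens_muls s t).
Proof. by apply/tensorP/tens_mulss; exact: tens_repr. Qed.

Lemma tens_addA : associative tens_add.
Proof.
by elim/tensorW=> s; elim/tensorW=> t; elim/tensorW=> u; rewrite !pi_tens_add catA.
Qed.

Lemma tens_addC : commutative tens_add.
Proof.
by elim/tensorW=> s; elim/tensorW=> t; rewrite !pi_tens_add; apply/tensorP/TRcatC.
Qed.

Lemma tens_add0 : left_id tens_zero tens_add.
Proof. by elim/tensorW=> s; rewrite pi_tens_add. Qed.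

Lemma tens_addN : left_inverse tens_zero tens_opp tens_add.
Proof.
by elim/tensorW=> s; rewrite pi_tens_opp pi_tens_add; apply/tensorP/tens_oppsN.
Qed.

HB.instance Definition _ :=
  GRing.isZmodule.Build tensor tens_addA tens_addC tens_add0 tens_addN.

Lemma tens_mulA : associative tens_mul.
Proof.
elim/tensorW=> s; elim/tensorW=> t; elim/tensorW=> u; rewrite !pi_tens_mul.
congr (\pi_tensor _).
elim: s => // p s IH; rewrite -cat1s !tens_muls_catl -IH; congr (_ ++ _).
rewrite /tens_muls /= !cats0 map_allpairs allpairs_mapl.
by apply: eq_allpairs => x y; rewrite /tens_mulp /= !mulrA.
Qed.

Lemma tens_mulC : commutative tens_mul.
Proof.
by elim/tensorW=> s; elim/tensorW=> t; rewrite !pi_tens_mul; apply/tensorP/tens_mulsC.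
Qed.

Lemma tens_mul1 : left_id tens_one tens_mul.
Proof.
elim/tensorW=> s; rewrite pi_tens_mul; congr (\pi_tensor _).
rewrite /tens_muls /= cats0 -[RHS]map_id; apply: eq_map => -[a b].
by rewrite /tens_mulp /= !mul1r.
Qed.

Lemma tens_mulDl : left_distributive tens_mul tens_add.
Proof.
elim/tensorW=> s; elim/tensorW=> t; elim/tensorW=> u.
by rewrite !(pi_tens_add, pi_tens_mul) tens_muls_catl.
Qed.

HB.instance Definition _ := GRing.Zmodule_isComPzRing.Build tensor
  tens_mulA tens_mulC tens_mul1 tens_mulDl.

Lemma pi_sum s : \pi_tensor s = \sum_(p <- s) tens p.1 p.2.
Proof.
elim: s => [|[a b] s IH]; first by rewrite big_nil.
by rewrite big_cons -IH -cat1s -pi_tens_add.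
Qed.

Lemma tensM a b a' b' : tens a b * tens a' b' = tens (a * a') (b * b').
Proof. by rewrite [LHS]pi_tens_mul. Qed.

Lemma tensDl a a' b : tens (a + a') b = tens a b + tens a' b.
Proof. by rewrite [RHS]pi_tens_add; apply/tensorP/TRaddl. Qed.

Lemma tensDr a b b' : tens a (b + b') = tens a b + tens a b'.
Proof. by rewrite [RHS]pi_tens_add; apply/tensorP/TRaddr. Qed.

Lemma tens_bal a c b : tens (a * iA c) b = tens a (iB c * b).
Proof. by apply/tensorP/TRbal. Qed.

(* The homomorphism a (x) b |-> f a * g b.  It is only meaningful when f and  *)
(* g agree on k; see tensor_lift_tens.                                        *)
Definition tensor_lift (C : pzRingType) (f : A -> C) (g : B -> C)
  (x : tensor) : C := \sum_(p <- repr x) f p.1 * g p.2.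

Section Lift.
Variables (C : comPzRingType) (f : {rmorphism A -> C}) (g : {rmorphism B -> C}).
Hypothesis fg : forall c, f (iA c) = g (iB c).

Lemma tensor_lift_pi s :
  tensor_lift f g (\pi_tensor s) = \sum_(p <- s) f p.1 * g p.2.
Proof.
rewrite /tensor_lift; have := tens_repr s; move: (repr _) => r.
elim=> {r s} //=.
- by move=> s t u _ -> _ ->.
- by move=> s s' t t' _ e _ e'; rewrite !big_cat /= e e'.
- by move=> s t; rewrite !big_cat /= addrC.
- by move=> b; rewrite big_seq1 big_nil /= rmorph0 mul0r.
- by move=> a a' b; rewrite !big_cons !big_nil /= !addr0 rmorphD mulrDl.
- by move=> a b b'; rewrite !big_cons !big_nil /= !addr0 rmorphD mulrDr.
- by move=> a c b; rewrite !big_seq1 /= !rmorphM fg mulrA.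
Qed.

Lemma tensor_lift_tens a b : tensor_lift f g (tens a b) = f a * g b.
Proof. by rewrite tensor_lift_pi big_seq1. Qed.

Lemma tensor_lift_zmod_morphism : zmod_morphism (tensor_lift f g).
Proof.
have liftD : {morph tensor_lift f g : x y / x + y}.
  elim/tensorW=> s; elim/tensorW=> t.
  by rewrite [X in tensor_lift _ _ X]pi_tens_add !tensor_lift_pi big_cat.
move=> x y; apply: (addIr (tensor_lift f g y)).
by rewrite -liftD !subrK.
Qed.

Lemma tensor_lift_monoid_morphism : monoid_morphism (tensor_lift f g).
Proof.
split; first by rewrite [LHS]tensor_lift_tens !rmorph1 mulr1.
elim/tensorW=> s; elim/tensorW=> t.
rewrite [X in tensor_lift _ _ X]pi_tens_mul !tensor_lift_pi big_distrlr /=.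
rewrite [LHS]big_allpairs_dep; apply: eq_bigr => p _; apply: eq_bigr => q _ /=.
by rewrite !rmorphM mulrACA.
Qed.
End Lift.

End Tensor.

Definition geometrically_integral (k : fieldType) (B : comNzRingType)
    (iB : {rmorphism k -> B}) : Prop :=
  forall (K : fieldType) (iK : {rmorphism k -> K}),
    integral_domain (tensor iK iB).

(* prime_idealr R bundles a proper prime ideal as a boolean predicate on R;   *)
(* classically, every prime ideal arises this way.                            *)

Definition Spec (R : comNzRingType) := prime_idealr R.

Section Zariski.
Variable R : comNzRingType.
Implicit Types (E : set R).

HB.instance Definition _ := gen_eqMixin (Spec R).
HB.instance Definition _ := gen_choiceMixin (Spec R).

Definition zero_locus E : set (Spec R) :=
  [set p : Spec R | forall x, E x -> x \in (p : {pred R})].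

Definition zariski_open : set_system (Spec R) :=
  [set U | exists E, U = ~` zero_locus E].

Lemma zariski_openT : zariski_open setT.
Proof.
exists [set 1]; apply/esym; rewrite -subTset => p _ /(_ 1 erefl).
by rewrite idealr1.
Qed.

Lemma zariski_openI : setI_closed zariski_open.
Proof.
move=> _ _ [E ->] [F ->]; exists [set z | exists x y, [/\ E x, F y & z = x * y]].
rewrite -setCU; congr (~` _); apply/seteqP; split=> p /=.
  case=> H z [x [y [Ex Fy ->]]]; rewrite prime_idealrM.
    by rewrite H.
  by rewrite (H y) ?orbT.
move=> H; apply: contrapT => /not_orP[].
move=> /existsNP[x /not_implyP[Ex /negP px]].
move=> /existsNP[y /not_implyP[Fy /negP py]].
have := H (x * y) (ex_intro _ x (ex_intro _ y (And3 Ex Fy erefl))).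
by rewrite prime_idealrM (negbTE px) (negbTE py).
Qed.

Lemma zariski_open_bigU (I : Type) (f : I -> set (Spec R)) :
  (forall i, zariski_open (f i)) -> zariski_open (\bigcup_i f i).
Proof.
move=> /choice[E fE]; exists (\bigcup_i E i).
apply/seteqP; split=> p /=.
  by case=> i _; rewrite fE => H H'; apply: H => x Ex; apply: H'; exists i.
move=> /existsNP[x /not_implyP[[i _ Ex] px]]; exists i => //.
by rewrite fE => /(_ x Ex).
Qed.

HB.instance Definition _ := isOpenTopological.Build (Spec R)
  zariski_openT zariski_openI zariski_open_bigU.

Lemma zariski_openE : (open : set_system (Spec R)) = zariski_open.
Proof. by []. Qed.

(* Here idealr R ranges over the proper ideals of R. *)
Definition maximal_ideal (m : Spec R) : Prop :=
  forall J : idealr R, {subset (m : {pred R}) <= (J : {pred R})} ->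
    {subset (J : {pred R}) <= (m : {pred R})}.

End Zariski.

(* Finite unions of locally closed sets.  This is the notion of constructible *)
(* set for Noetherian spaces, where every open set is retrocompact; it is not *)
(* the right one for an arbitrary spectrum.                                   *)
Definition constructible (T : topologicalType) (A : set T) : Prop :=
  exists (n : nat) (U Z : 'I_n -> set T),
    [/\ forall i, open (U i), forall i, closed (Z i) &
        A = \bigcup_(i in [set: 'I_n]) (U i `&` Z i)].

(* For a domain R, the local ring R_p is realised inside Frac R.              *)
Section ResidueField.
Variables (R : idomainType) (p : Spec R).
Local Notation "x %:F" := (@FracField.tofrac R x).
Local Notation P := (p : {pred R}).

Definition local_pred : {pred {fraction R}} :=
  fun x => `[< exists a s : R, s \notin P /\ x = a%:F / s%:F >].

Lemma notin_prime_neq0 s : s \notin P -> s%:F != 0 :> {fraction R}.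
Proof. by apply: contraNneq => /eqP; rewrite tofrac_eq0 => /eqP ->; exact: idealr0. Qed.

Lemma notin_prime1 : 1 \notin P.
Proof. by rewrite idealr1. Qed.

Lemma notin_primeM s t : s \notin P -> t \notin P -> s * t \notin P.
Proof. by move=> sp tp; rewrite prime_idealrM negb_or sp. Qed.

Lemma local_pred_subring : subring_closed local_pred.
Proof.
split.
- apply/asboolP; exists 1, 1; split; first exact: notin_prime1.
  by rewrite tofrac1 divr1.
- move=> _ _ /asboolP[a [s [sp ->]]] /asboolP[b [t [tp ->]]].
  apply/asboolP; exists (a * t - b * s), (s * t).
  split; first exact: notin_primeM.
  rewrite -mulNr addf_div ?notin_prime_neq0 // mulNr.
  by rewrite tofracB !tofracM.
- move=> _ _ /asboolP[a [s [sp ->]]] /asboolP[b [t [tp ->]]].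
  apply/asboolP; exists (a * b), (s * t).
  split; first exact: notin_primeM.
  by rewrite !tofracM mulf_div.
Qed.
HB.instance Definition _ :=
  GRing.isSubringClosed.Build {fraction R} local_pred local_pred_subring.

Definition localization := {x : {fraction R} | x \in local_pred}.
HB.instance Definition _ := SubChoice.on localization.
HB.instance Definition _ :=
  [SubChoice_isSubComNzRing of localization by <:].

Lemma to_localization_subproof (a : R) : a%:F \in local_pred.
Proof.
apply/asboolP; exists a, 1; split; first exact: notin_prime1.
by rewrite tofrac1 divr1.
Qed.

Definition to_localization (a : R) : localization :=
  Sub a%:F (to_localization_subproof a).

Lemma to_localization_zmod_morphism : zmod_morphism to_localization.
Proof. by move=> a b; apply: val_inj; rewrite /= tofracB. Qed.
Lemma to_localization_monoid_morphism : monoid_morphism to_localization.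
Proof.
by split=> [|a b]; apply: val_inj; rewrite /= ?tofrac1 ?tofracM.
Qed.
HB.instance Definition _ := GRing.isZmodMorphism.Build R localization
  to_localization to_localization_zmod_morphism.
HB.instance Definition _ := GRing.isMonoidMorphism.Build R localization
  to_localization to_localization_monoid_morphism.

(* The extended ideal p R_p. *)
Definition local_max : {pred localization} :=
  fun x => `[< exists a s : R, [/\ a \in P, s \notin P & val x = a%:F / s%:F] >].

Lemma local_max_idealr : idealr_closed local_max.
Proof.
split.
- apply/asboolP; exists 0, 1; split; [exact: idealr0|exact: notin_prime1|].
  by rewrite /= tofrac0 mul0r.
- apply/asboolP => -[a [s [ap sp /=]]] /(congr1 ( *%R^~ s%:F)).
  rewrite mul1r divfK ?notin_prime_neq0 // => /eqP.
  by rewrite tofrac_eq => /eqP sa; rewrite sa ap in sp.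
- move=> x u v /asboolP[a [s [ap sp eu]]] /asboolP[b [t [bp tp ev]]].
  have /asboolP[c [r [rp ex]]] := valP x.
  apply/asboolP; exists (c * a * t + b * (r * s)), (r * s * t); split.
  + by rewrite [c * a * t]mulrC [b * _]mulrC rpredD // !idealMr.
  + by rewrite !notin_primeM.
  rewrite /= eu ev ex mulf_div addf_div ?mulf_neq0 ?notin_prime_neq0 //.
  by rewrite tofracD !tofracM.
Qed.
HB.instance Definition _ :=
  isIdealr.Build localization local_max local_max_idealr.

Definition residue_field := {ideal_quot local_max}.
HB.instance Definition _ := GRing.ComNzRing.on residue_field.

Definition residue_inv (x : residue_field) : residue_field :=
  if pselect (exists y, y * x = 1) is left h then projT1 (cid h) else 0.

Lemma residue_mulV x : x != 0 -> residue_inv x * x = 1.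
Proof.
move=> x0; rewrite /residue_inv; case: pselect => [h|]; first by case: cid.
case; elim/quotW: x x0 => x.
have -> : (0 : residue_field) = \pi_residue_field 0 by rewrite rmorph0.
move=> x0; have {}x0 : x \notin local_max.
  by apply: contra x0 => xm; rewrite -Quotient.idealrBE subr0.
have /asboolP[a [s [sp ex]]] := valP x.
have ap : a \notin P.
  by apply: contra x0 => ap; apply/asboolP; exists a, s.
have yP : s%:F / a%:F \in local_pred by apply/asboolP; exists s, a.
exists (\pi_residue_field (Sub (s%:F / a%:F) yP)).
rewrite -rmorphM -[RHS](rmorph1 (\pi_residue_field)); congr (\pi_residue_field _).
apply: val_inj; rewrite /= ex mulf_div [a%:F * _]mulrC divff //.
by rewrite mulf_neq0 ?notin_prime_neq0.
Qed.

Lemma residue_inv0 : residue_inv 0 = 0.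
Proof.
rewrite /residue_inv; case: pselect => // h; case: cid => y /=.
by rewrite mulr0 => /esym/eqP; rewrite oner_eq0.
Qed.

HB.instance Definition _ :=
  GRing.ComNzRing_isField.Build residue_field residue_mulV residue_inv0.

Definition to_residue (a : R) : residue_field :=
  \pi_residue_field (to_localization a).

Lemma to_residue_zmod_morphism : zmod_morphism to_residue.
Proof. by move=> a b; rewrite /to_residue !rmorphB. Qed.
Lemma to_residue_monoid_morphism : monoid_morphism to_residue.
Proof. by split=> [|a b]; rewrite /to_residue ?rmorph1 ?rmorphM. Qed.
HB.instance Definition _ := GRing.isZmodMorphism.Build R residue_field
  to_residue to_residue_zmod_morphism.
HB.instance Definition _ := GRing.isMonoidMorphism.Build R residue_field
  to_residue to_residue_monoid_morphism.

End ResidueField.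

Section Psi.
Variables (k : fieldType) (R B : idomainType).
Variables (iR : {rmorphism k -> R}) (iB : {rmorphism k -> B}).
Variables (N : nat) (Psi : {rmorphism B -> {mpoly R[N]}}).

Definition Psi_at (p : Spec R) :
    {rmorphism B -> {mpoly (residue_field p)[N]}} :=
  map_mpoly (to_residue p) \o Psi.

Definition residue_tensor (p : Spec R) : comPzRingType :=
  tensor (to_residue p \o iR) iB.

Definition hat_Psi (p : Spec R) :
    residue_tensor p -> {mpoly (residue_field p)[N]} :=
  tensor_lift (fun c : residue_field p => c%:MP_[N]) (Psi_at p).

Lemma hat_Psi_tens (p : Spec R) :
  (forall c : k, Psi (iB c) = (iR c)%:MP_[N]) ->
  forall (c : residue_field p) (b : B),
    hat_Psi (tens _ _ c b) = c *: Psi_at p b.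
Proof.
move=> PsiE c b; rewrite -mul_mpolyC.
apply: (tensor_lift_tens (f := @mpolyC N (residue_field p))) => d /=.
by rewrite PsiE map_mpolyC.
Qed.

Definition inj_locus : set (Spec R) :=
  [set p | injective (@hat_Psi p)].

End Psi.

(* Main.v *)
Require Import Defs.
From HB Require Import structures.
From mathcomp Require Import all_boot all_order all_algebra.
From mathcomp Require Import generic_quotient ring_quotient fraction mpoly.
From mathcomp Require Import boolp classical_sets filter topology_structure.

(** Injectivity of the fibre map at a prime p says that one fixed family of
    elements of B stays linearly independent at p. Choose t_1, ..., t_d in B
    algebraically independent over k and e_1, ..., e_r in B forming a basis of
    Frac B over k(t) ([poly_basis_exists]). After multiplication by some nonzero
    c(t), every element of the tensor product of kappa(p) with B becomes a
    combination of the e_j with coefficients in kappa(p)[t], and 1 (x) c(t) is not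
    a zero divisor. Hence the fibre map is injective iff no nontrivial relation
    sum_j P_j(t) e_j = 0 holds between the images in kappa(p)[X] ([inj_locusP]).
    
    Relations whose coefficients P_j have degree less than D are a matter of
    finite linear algebra over R, so the set U_D of the primes without such
    relations is open: it is described by minors. The locus is the intersection
    of the decreasing sequence U_D, and the point is that this sequence reaches
    it. Otherwise some ultrafilter on Spec R contains every U_D minus the locus;
    let q be the prime of those a that belong to p for almost all p
    ([ultrafilter_spec_limit]). A relation at q lifts to R and would hold at almost
    all p, so there is none, and q is in the locus. But independence at q has a
    finite witness. Extend t by some of the variables X_i to a transcendence basis
    of kappa(q)(X), and the e_j to a basis of kappa(q)(X) over the purely
    transcendental field kappa(q)(T) so obtained ([frac_basis_extension]). The
    variables X_i then act by commuting matrices, for which t_l acts as the scalar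
    T_l and e_j maps the coordinate vector of 1 to the j-th basis vector. Matrices
    with these properties force independence ([certificate_indep]); their entries
    are quotients of polynomials over R, so reducing them gives such matrices at
    almost all p ([independence_spreads]). Thus almost all p are in the locus, a
    contradiction. So the locus equals some U_D: it is even open.
    
    For a maximal ideal m, the field kappa(m) is a quotient of R, hence algebraic
    over k by Zariski's lemma ([fg_field_algebraic]), and the tensor product of
    kappa(m) with B is integral over B. When it is a domain, a nonzero z in the
    kernel of the fibre map has an integral equation with nonzero constant term
    b in B, and applying the map to this equation shows that b is a nonzero element
    of the kernel of Psi^m ([tensor_lift_inj_of_inj]). *)

Set Implicit Arguments.
Unset Strict Implicit.
Unset Printing Implicit Defensive.

Import GRing.Theory.
Local Open Scope classical_set_scope.
Local Open Scope ring_scope.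

(** * Fractions and linear independence *)

Notation "x %:F" := (@FracField.tofrac _ x).

(** The common denominator argument in abstract form: [Q j a] reads: a clears the
    j-th denominator. *)
Lemma common_multiplier (A : comNzRingType) (S : A -> Prop) (Q : nat -> A -> Prop) :
  S 1 -> (forall a b, S a -> S b -> S (a * b)) ->
  (forall j a b, Q j a -> Q j (b * a)) ->
  (forall j, exists2 a, S a & Q j a) ->
  forall n, exists2 a, S a & forall j, (j < n)%N -> Q j a.
Proof.
move=> S1 SM QM QS; elim=> [|n [a Sa Qa]]; first by exists 1.
have [b Sb Qb] := QS n; exists (b * a); first exact: SM.
move=> j; rewrite ltnS leq_eqVlt => /orP[/eqP ->|/Qa]; last exact: QM.
by rewrite mulrC; apply: QM.
Qed.

Lemma fracE (A : idomainType) (x : {fraction A}) :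
  exists n c : A, c != 0 /\ x = n%:F / c%:F.
Proof.
elim/quotW: x => x; exists (frac x).1, (frac x).2.
split; first exact: denom_ratioP.
have d0 : ((frac x).2)%:F != 0 :> {fraction A} by rewrite tofrac_eq0 denom_ratioP.
apply: (mulIf d0); rewrite mulfVK //.
unlock FracField.tofrac; rewrite -[LHS]FracField.pi_mul; apply/eqmodP/eqP => /=.
rewrite /= /FracField.mulf !numden_Ratio ?(oner_neq0, mulr1, denom_ratioP) //.
by rewrite mulrC.
Qed.

Lemma frac_common_denom (A : idomainType) (x : nat -> {fraction A}) (r : nat) :
  exists c : A, c != 0 /\
    exists a : nat -> A, forall j, (j < r)%N -> c%:F * x j = (a j)%:F.
Proof.
have [|a b||j|c c0 cP] := @common_multiplier A (fun c => c != 0)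
    (fun j c => exists a, c%:F * x j = a%:F) _ _ _ _ r.
- exact: oner_neq0.
- exact: mulf_neq0.
- by move=> j a b [a' e]; exists (b * a'); rewrite rmorphM -mulrA e -rmorphM.
- have [n [c [c0 ->]]] := fracE (x j); exists c => //; exists n.
  by rewrite mulrC divfK // tofrac_eq0.
exists c; split=> //.
have /choice[a aP] : forall j, exists a, (j < r)%N -> c%:F * x j = a%:F.
  move=> j; have [/cP[a e]|jr] := boolP (j < r)%N; first by exists a.
  by exists 0.
by exists a.
Qed.

(** The universal property of the field of fractions. The value at n/c is defined
    as the unique element compatible with all representations of the fraction. *)
Lemma frac_lift (A : idomainType) (L : fieldType) (eps : {rmorphism A -> L}) :
  injective eps ->
  exists iota : {rmorphism {fraction A} -> L}, forall a, iota a%:F = eps a.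
Proof.
move=> inj.
have eps0 c : c != 0 -> eps c != 0 by rewrite -(inj_eq inj) rmorph0.
have /choice[f fP] : forall x : {fraction A}, exists y : L,
    forall n c, c != 0 -> x = n%:F / c%:F -> y = eps n / eps c.
  move=> x; have [n [c [c0 ->]]] := fracE x; exists (eps n / eps c) => n' c' c'0.
  move/eqP; rewrite eqr_div ?tofrac_eq0 // -!rmorphM tofrac_eq => /eqP e.
  by apply/eqP; rewrite eqr_div ?eps0 // -!rmorphM e.
have fD : zmod_morphism f.
  move=> x y; have [n [c [c0 ex]]] := fracE x; have [m [b [b0 ey]]] := fracE y.
  rewrite (fP _ _ _ c0 ex) (fP _ _ _ b0 ey).
  rewrite (fP _ (n * b - m * c) (c * b)) ?mulf_neq0 //; last first.
    by rewrite ex ey -[- (m%:F / _)]mulNr addf_div ?tofrac_eq0 // mulNr rmorphB !rmorphM.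
  by rewrite -[- (eps m / _)]mulNr addf_div ?eps0 // mulNr rmorphB !rmorphM.
have fM : monoid_morphism f.
  split.
    rewrite (fP 1 1 1) ?oner_neq0 ?rmorph1 ?divr1 //.
  move=> x y; have [n [c [c0 ex]]] := fracE x; have [m [b [b0 ey]]] := fracE y.
  rewrite (fP _ _ _ c0 ex) (fP _ _ _ b0 ey) mulf_div.
  rewrite (fP _ (n * m) (c * b)) ?mulf_neq0 ?rmorphM //.
  by rewrite ex ey mulf_div.
pose Z := GRing.isZmodMorphism.Build _ _ f fD.
pose M := GRing.isMonoidMorphism.Build _ _ f fM.
pose F : {rmorphism {fraction A} -> L} := HB.pack f Z M.
exists F => a; rewrite [LHS](fP _ a 1) ?oner_neq0 ?rmorph1 ?divr1 //.
Qed.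

(** Families are indexed by nat and cut at a length [r], so that a family can be
    extended without changing its type. *)
Definition lin_indep (A C : pzRingType) (eps : A -> C) (r : nat) (w : nat -> C) :=
  forall a : nat -> A, \sum_(j < r) eps (a j) * w j = 0 ->
    forall j, (j < r)%N -> a j = 0.

(** A relation with fractional coefficients becomes one with coefficients in the
    ring after multiplication by a common denominator. *)
Lemma lin_indep_frac (A C : idomainType) (eps : {rmorphism A -> C})
    (iota : {rmorphism {fraction A} -> {fraction C}}) r w :
  (forall a, iota a%:F = (eps a)%:F) ->
  lin_indep eps r w -> lin_indep iota r (fun j => (w j)%:F).
Proof.
move=> iE ind x x0 j jr.
have [c [c0 [a xa]]] := frac_common_denom x r.
have := ind a; have -> : \sum_(j < r) eps (a j) * w j = 0.
  apply/eqP; rewrite -tofrac_eq0 raddf_sum /=.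
  rewrite (eq_bigr (fun j : 'I_r => (eps c)%:F * (iota (x j) * (w j)%:F))).
    by rewrite -mulr_sumr x0 mulr0.
  by move=> i _; rewrite mulrA -!iE -rmorphM xa // iE rmorphM.
move=> /(_ erefl j jr) aj0; have := xa _ jr; rewrite aj0 rmorph0 => /eqP.
by rewrite mulf_eq0 tofrac_eq0 (negbTE c0) => /eqP.
Qed.

Lemma lin_indep_of_frac (A C : idomainType) (eps : {rmorphism A -> C})
    (iota : {rmorphism {fraction A} -> {fraction C}}) r w :
  (forall a, iota a%:F = (eps a)%:F) ->
  lin_indep iota r (fun j => (w j)%:F) -> lin_indep eps r w.
Proof.
move=> iE ind a a0 j jr; apply/eqP; rewrite -tofrac_eq0; apply/eqP.
apply: (ind (fun j => (a j)%:F)) => //.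
have := congr1 (@FracField.tofrac C) a0; rewrite rmorph0 rmorph_sum => e0.
by rewrite -[RHS]e0; apply: eq_bigr => l _; rewrite iE -rmorphM.
Qed.

(** More than m vectors with m coordinates each have a nonzero relation, given by
    the kernel of the matrix of coordinates. *)
Lemma lin_indep_le_span (F L : fieldType) (iota : {rmorphism F -> L})
    (m : nat) (u : 'I_m -> L) (r : nat) (w : nat -> L) :
  (forall j, (j < r)%N -> exists a : 'I_m -> F, w j = \sum_i iota (a i) * u i) ->
  lin_indep iota r w -> (r <= m)%N.
Proof.
move=> sp ind; rewrite leqNgt; apply/negP => mr.
have /choice[a aP] : forall j : 'I_r, exists a : 'I_m -> F, w j = \sum_i iota (a i) * u i.
  by move=> j; apply: sp.
pose W := \matrix_(j < r, i < m) a j i.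
have : kermx W != 0.
  rewrite kermx_eq0 -row_leq_rank -ltnNge; exact: leq_ltn_trans (rank_leq_col _) mr.
case/rowV0Pn => v /sub_kermxP vW v0.
case/negP: v0; apply/eqP/rowP => j; rewrite mxE.
pose l (n : nat) := if insub n is Some i then v 0 i else 0.
have lE (i : 'I_r) : l i = v 0 i by rewrite /l valK.
rewrite -lE; apply: ind => //.
under eq_bigr => i _ do rewrite lE aP mulr_sumr.
rewrite exchange_big big1 //= => i _.
have := congr1 (fun B : 'rV_m => iota (B 0 i)) vW; rewrite !mxE rmorph0 rmorph_sum /=.
move=> e; rewrite (eq_bigr (fun j => iota (v 0 j * W j i) * u i)).
  by rewrite -mulr_suml e mul0r.
by move=> s _; rewrite mxE rmorphM mulrA.
Qed.

(** The subset V need not be a subspace: new basis vectors are picked in V as long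
    as some element of V is outside the span, and the finite spanning family bounds
    the number of steps. *)
Lemma lin_indep_extend_basis (F L : fieldType) (iota : {rmorphism F -> L})
    (V : L -> Prop) (m : nat) (u : 'I_m -> L) (r : nat) (w : nat -> L) :
  (forall x, V x -> exists a : 'I_m -> F, x = \sum_i iota (a i) * u i) ->
  (forall j, (j < r)%N -> V (w j)) ->
  lin_indep iota r w ->
  exists (s : nat) (z : nat -> L), [/\ (r <= s)%N, forall j, (j < r)%N -> z j = w j,
    forall j, (j < s)%N -> V (z j), lin_indep iota s z &
    forall x, V x -> exists a : nat -> F, x = \sum_(j < s) iota (a j) * z j].
Proof.
(* Induction on the room left below the bound m on independent families. *)
move=> sp; have [n le] : exists n, (m < r + n)%N.
  by exists m.+1; rewrite addnS ltnS leq_addl.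
elim: n r w le => [|n IH] r w le Vw ind.
  have := @lin_indep_le_span _ _ iota _ u r w (fun j jr => sp _ (Vw j jr)) ind.
  by rewrite leqNgt -[r]addn0 le.
have [H|] := pselect (forall x, V x ->
    exists a : nat -> F, x = \sum_(j < r) iota (a j) * w j); first by exists r, w.
move=> /existsNP[x /not_implyP[Vx xP]].
pose w' j := if j == r then x else w j.
have w'E j : (j < r)%N -> w' j = w j by rewrite /w' => jr; rewrite ltn_eqF.
have [|||s [z [h1 h2 h3 h4 h5]]] := IH r.+1 w'; first by rewrite addSnnS.
- move=> j; rewrite ltnS leq_eqVlt => /orP[/eqP ->|jr]; first by rewrite /w' eqxx.
  by rewrite w'E //; apply: Vw.
- move=> a; rewrite big_ord_recr /= {2}/w' eqxx.
  rewrite (eq_bigr (fun j : 'I_r => iota (a j) * w j)); last by move=> j _; rewrite w'E.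
  move=> e; have ar : a r = 0.
    apply/eqP; apply: contrapT => /negP ar; apply: xP; exists (fun j => - (a j / a r)).
    apply: (mulfI (x := iota (a r))); first by rewrite fmorph_eq0.
    move/eqP: e; rewrite addrC addr_eq0 => /eqP ->; rewrite -sumrN mulr_sumr.
    apply: eq_bigr => j _; rewrite rmorphN fmorph_div mulNr mulrN; congr (- _).
    by rewrite mulrA [_ * (_ / _)]mulrC mulfVK ?fmorph_eq0.
  rewrite ar rmorph0 mul0r addr0 in e => j.
  by rewrite ltnS leq_eqVlt => /orP[/eqP -> //|]; exact: ind.
exists s, z; split=> //; first exact: ltnW.
by move=> j jr; rewrite h2 ?w'E // ltnS ltnW.
Qed.

(** * Polynomial evaluation and algebraic elements *)

(** Like families, the points at which polynomials are evaluated are given by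
    functions on nat of which only the first d values count. *)
Definition peval (F C : comNzRingType) (i : {rmorphism F -> C}) (G : nat -> C)
  (d : nat) (P : {mpoly F[d]}) : C := mmap i (fun l : 'I_d => G l) P.
Arguments peval {F C} i G d P : simpl never.

HB.instance Definition _ (F C : comNzRingType) (i : {rmorphism F -> C}) (G : nat -> C) d :=
  GRing.RMorphism.copy (peval i G d) (mmap i (fun l : 'I_d => G l)).

Lemma eq_peval (F C : comNzRingType) (i : {rmorphism F -> C}) (G H : nat -> C) d :
  (forall l, (l < d)%N -> G l = H l) -> peval i G d =1 peval i H d.
Proof.
move=> GH P; rewrite /peval /mmap; apply: eq_bigr => m _; congr (_ * _).
by apply: mmap1_eq => l; apply: GH.
Qed.

Lemma pevalC (F C : comNzRingType) (i : {rmorphism F -> C}) (G : nat -> C) d c :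
  peval i G d c%:MP = i c.
Proof. exact: mmapC. Qed.

Lemma pevalX (F C : comNzRingType) (i : {rmorphism F -> C}) (G : nat -> C) d
  (l : 'I_d) : peval i G d 'X_l = G l.
Proof. by rewrite /peval mmapX mmap1U. Qed.

Lemma mpoly0_const (F : nzRingType) (P : {mpoly F[0]}) : P = (P@_0%MM)%:MP.
Proof.
apply/mpolyP => m; have -> : m = 0%MM by apply/mnmP; case.
by rewrite mcoeffC eqxx mulr1.
Qed.

Lemma peval_map (F K C : comNzRingType) (i : {rmorphism K -> C}) (f : {rmorphism F -> K})
    (G : nat -> C) d (P : {mpoly F[d]}) :
  peval i G d (map_mpoly f P) = peval (i \o f) G d P.
Proof.
rewrite rmorph_sum; apply: eq_bigr => m _; rewrite rmorphM /= pevalC; congr (_ * _).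
by rewrite rmorph_prod; apply: eq_bigr => l _; rewrite rmorphXn /= pevalX.
Qed.

Lemma peval_rmorph (F C D : comNzRingType) (i : {rmorphism F -> C}) (f : {rmorphism C -> D})
    (G : nat -> C) d (P : {mpoly F[d]}) :
  f (peval i G d P) = peval (f \o i) (f \o G) d P.
Proof.
rewrite rmorph_sum; apply: eq_bigr => m _; rewrite rmorphM; congr (_ * _).
by rewrite rmorph_prod; apply: eq_bigr => l _; rewrite rmorphXn.
Qed.

Lemma eq_peval_coef (F C : comNzRingType) (i j : {rmorphism F -> C}) (G : nat -> C) d :
  i =1 j -> peval i G d =1 peval j G d.
Proof. by move=> ij P; apply: eq_bigr => m _; rewrite ij. Qed.

Lemma mpoly_gen (F : comNzRingType) N (b : {mpoly F[N]}) :
  mmap (@mpolyC N F) (fun l => 'X_l) b = b.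
Proof.
rewrite [in RHS](mpolyE b); apply: eq_bigr => m _.
by rewrite mul_mpolyC mpolyXE_id.
Qed.

Lemma peval_widen (F C : comNzRingType) (i : {rmorphism F -> C}) (G : nat -> C) d P :
  peval i G d.+1 (mwiden P) = peval i G d P.
Proof.
rewrite rmorph_sum; apply: eq_bigr => m _; rewrite rmorphM /= pevalC; congr (_ * _).
by rewrite rmorph_prod; apply: eq_bigr => l _; rewrite rmorphXn /= pevalX.
Qed.

(** Evaluation in d + 1 points goes through the isomorphism with univariate
    polynomials over the polynomials in d variables. *)
Lemma peval_muni (F C : comNzRingType) (i : {rmorphism F -> C}) (G : nat -> C) d P :
  peval i G d.+1 P = (map_poly (peval i G d) (muni P)).[G d].
Proof.
rewrite muniE rmorph_sum horner_sum; apply: eq_bigr => m _ /=.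
rewrite map_polyZ map_polyXn hornerZ hornerXn /= /peval mmapZ mmapX -mulrA; congr (_ * _).
by rewrite /mmap1 big_ord_recr /=; congr (_ * _); apply: eq_bigr => l _; rewrite mnmE.
Qed.

(** By [peval_muni], P is recovered from [muni P] by evaluation at the variables. *)
Lemma muni_inj0 (F : comNzRingType) d (P : {mpoly F[d.+1]}) : muni P = 0 -> P = 0.
Proof.
move=> P0; pose G (l : nat) : {mpoly F[d.+1]} := 'X_(inord l).
have : peval (@mpolyC d.+1 F) G d.+1 P = P.
  rewrite [in RHS](mpolyE P) /= /mmap; apply: eq_bigr => m _.
  rewrite mul_mpolyC mpolyXE_id; congr (_ *: _); apply: eq_bigr => l _.
  by rewrite /G inord_val.
by rewrite peval_muni P0 map_poly0 horner0.
Qed.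

Definition algebraic_elt (A C : nzRingType) (eps : A -> C) (b : C) :=
  exists2 q : {poly A}, q != 0 & root (map_poly eps q) b.

Lemma algebraic_elt_widen (F C : comNzRingType) (i : {rmorphism F -> C})
    (G H : nat -> C) d b : (forall l, (l < d)%N -> H l = G l) ->
  algebraic_elt (peval i G d) b -> algebraic_elt (peval i H d.+1) b.
Proof.
move=> HG [q q0 qb]; exists (map_poly (@mwiden d F) q).
  rewrite map_poly_eq0_id0 // -(mwiden0 d) (inj_eq (@inj_mwiden _ _)).
  by rewrite lead_coef_eq0.
rewrite -map_poly_comp /=.
rewrite (eq_map_poly (g := peval i G d)) // => P.
by rewrite [LHS]peval_widen; apply: eq_peval.
Qed.

Section FractionEmbedding.
Variables (A C : idomainType) (eps : {rmorphism A -> C}).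
Variable (iota : {rmorphism {fraction A} -> {fraction C}}).
Hypothesis iotaE : forall a, iota a%:F = (eps a)%:F.

(** Over fields algebraic and integral elements agree, and denominators can be
    cleared; so sums and products of algebraic elements are available for rings
    through integral closure in the fraction fields. *)
Lemma algebraic_eltP b : algebraic_elt eps b <-> integralOver iota b%:F.
Proof.
split=> [[q q0 qb]|/integral_algebraic[q q0 qb]].
  apply/integral_algebraic; exists (map_poly (@FracField.tofrac A) q).
    rewrite map_poly_eq0_id0 // tofrac_eq0 lead_coef_eq0 //.
  rewrite -map_poly_comp /= (eq_map_poly (g := (@FracField.tofrac C) \o eps)) //.
  by rewrite map_poly_comp /= /root horner_map /= (eqP qb) rmorph0.
have [c [c0 [a qa]]] := frac_common_denom (fun j => q`_j) (size q).
pose p := \poly_(j < size q) a j.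
have pE : map_poly (@FracField.tofrac A) p = c%:F *: q.
  apply/polyP => j; rewrite coef_map coefZ coef_poly.
  by case: ltnP => jq; rewrite /= -?qa // nth_default // mulr0 rmorph0.
exists p.
  apply: contraNneq q0 => p0; move/eqP: pE; rewrite p0 map_poly0 eq_sym.
  by rewrite scaler_eq0 tofrac_eq0 (negbTE c0).
rewrite /root -tofrac_eq0 -horner_map /= -map_poly_comp /=.
rewrite (eq_map_poly (g := iota \o (@FracField.tofrac A))); last by move=> x /=; rewrite iotaE.
by rewrite map_poly_comp /= pE map_polyZ hornerZ (eqP qb) mulr0.
Qed.
End FractionEmbedding.

Lemma lin_indep_inj (A C : idomainType) (eps : {rmorphism A -> C}) r w :
  (0 < r)%N -> lin_indep eps r w -> injective eps.
Proof.
move=> r0 ind; apply: raddf_inj => a ea.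
apply: (ind (fun=> a) _ 0%N r0).
by apply: big1 => j _; rewrite ea mul0r.
Qed.

Lemma frac_embed_exists (A C : idomainType) (eps : {rmorphism A -> C}) r w :
  (0 < r)%N -> lin_indep eps r w ->
  exists iota : {rmorphism {fraction A} -> {fraction C}},
    forall a, iota a%:F = (eps a)%:F.
Proof.
move=> r0 ind; apply: (frac_lift (eps := @FracField.tofrac C \o eps)).
by move=> a b /= /eqP; rewrite tofrac_eq => /eqP; exact: (lin_indep_inj r0 ind).
Qed.

(** Collecting the powers of y = G_d in a relation between the h_j turns it into a
    polynomial equation for y. Its coefficients are combinations of the algebraic
    elements h_j, and one of them is nonzero because the h_j are independent before
    y is adjoined. So y is algebraic over an algebraic extension, hence algebraic. *)
Lemma algebraic_of_dependent (F : fieldType) (C : idomainType) (i : {rmorphism F -> C})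
    (d : nat) (G : nat -> C) (r : nat) (h : nat -> C) :
  (0 < r)%N -> lin_indep (peval i G d) r h ->
  (forall j, (j < r)%N -> algebraic_elt (peval i G d) (h j)) ->
  ~ lin_indep (peval i G d.+1) r h -> algebraic_elt (peval i G d) (G d).
Proof.
move=> r0 ind alg /existsNP[P /not_implyP[P0 /existsNP[j0 /not_implyP[j0r Pj0]]]].
have [iota iE] := frac_embed_exists r0 ind.
pose Q := \sum_(j < r) map_poly (peval i G d) (muni (P j)) * (h j)%:P.
have QE s : Q`_s = \sum_(j < r) peval i G d (muni (P j))`_s * h j.
  by rewrite coef_sum; apply: eq_bigr => j _; rewrite coefMC coef_map.
have Q0 : Q != 0.
  apply: contra_notN Pj0 => /eqP Q0; apply: muni_inj0; apply/polyP => s.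
  rewrite coef0; apply: (ind (fun j => (muni (P j))`_s)) => //.
  by rewrite -QE Q0 coef0.
apply/(algebraic_eltP iE).
apply: (@integral_root _ _ iota (map_poly (@FracField.tofrac C) Q)); last first.
- apply/integral_poly => s; rewrite coef_map /= QE rmorph_sum.
  elim/big_ind: _ => [|x z ix iz|j _]; first exact: integral0.
    exact: integral_add ix iz.
  rewrite rmorphM /= -iE; apply: integral_mul; first exact: integral_id.
  by apply/(algebraic_eltP iE)/alg.
- rewrite /root horner_map /= tofrac_eq0 /Q horner_sum.
  under eq_bigr => j _ do rewrite hornerM hornerC -peval_muni.
  by rewrite P0.
- by rewrite map_poly_eq0_id0 ?tofrac_eq0 ?lead_coef_eq0.
Qed.

(** The elements y_l are treated one after the other: y_l is either appended to
    the transcendental family, if the h_j stay independent, or algebraic over it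
    by [algebraic_of_dependent]. Keeping the h_j independent along the way is what
    later lets them be part of a basis over the larger subfield. *)
Lemma transcendence_extension (F : fieldType) (C : idomainType) (i : {rmorphism F -> C})
    (n : nat) (y : 'I_n -> C) (d : nat) (g : nat -> C) (r : nat) (h : nat -> C) :
  (0 < r)%N -> lin_indep (peval i g d) r h ->
  (forall j, (j < r)%N -> algebraic_elt (peval i g d) (h j)) ->
  exists (e : nat) (G : nat -> C), [/\ (d <= e)%N,
    forall l, (l < d)%N -> G l = g l, lin_indep (peval i G e) r h,
    forall j, (j < r)%N -> algebraic_elt (peval i G e) (h j) &
    forall l, algebraic_elt (peval i G e) (y l)].
Proof.
move=> r0 ind alg.
suff H m : (m <= n)%N -> exists (e : nat) (G : nat -> C), [/\ (d <= e)%N,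
    forall l, (l < d)%N -> G l = g l, lin_indep (peval i G e) r h,
    forall j, (j < r)%N -> algebraic_elt (peval i G e) (h j) &
    forall l : 'I_n, (l < m)%N -> algebraic_elt (peval i G e) (y l)].
  have [e [G [h1 h2 h3 h4 h5]]] := H n (leqnn n).
  by exists e, G; split=> // l; apply: h5.
elim: m => [|m IH] mn; first by exists d, g.
have [e [G [h1 h2 h3 h4 h5]]] := IH (ltnW mn).
pose H l := if l == e then y (Ordinal mn) else G l.
have HG l : (l < e)%N -> H l = G l by rewrite /H => le; rewrite ltn_eqF.
have He : H e = y (Ordinal mn) by rewrite /H eqxx.
have new (P : C -> Prop) : P (y (Ordinal mn)) ->
    (forall l : 'I_n, (l < m)%N -> P (y l)) -> forall l : 'I_n, (l < m.+1)%N -> P (y l).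
  move=> Pm PP l; rewrite ltnS leq_eqVlt => /orP[/eqP lm|/PP //].
  by rewrite (_ : l = Ordinal mn) //; apply: val_inj.
have [indH|dep] := pselect (lin_indep (peval i H e.+1) r h).
  exists e.+1, H; split=> //; first exact: leqW.
  - by move=> l ld; rewrite HG ?h2 // (leq_trans ld).
  - by move=> j jr; apply: algebraic_elt_widen (h4 j jr).
  apply: new => [|l lm]; last by apply: algebraic_elt_widen (h5 l lm).
  exists ('X - ('X_ord_max)%:P); first by rewrite polyXsubC_eq0.
  by rewrite rmorphB /= map_polyX map_polyC /= pevalX He root_XsubC.
have eqHG : peval i H e =1 peval i G e by apply: eq_peval.
exists e, G; split=> //; apply: new => //.
rewrite -He; have [||q q0 qH] := @algebraic_of_dependent _ _ i e H r h r0 _ _ dep.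
- move=> a e0; apply: h3; rewrite -[RHS]e0.
  by apply: eq_bigr => j _; rewrite eqHG.
- move=> j /h4[q q0 qh]; exists q => //.
  by rewrite (eq_map_poly eqHG).
by exists q => //; rewrite -(eq_map_poly eqHG).
Qed.

(** * Bases of a fraction field over a purely transcendental subfield *)

(** The coefficients come from the remainder of X^k by a monic equation of y. *)
Lemma integral_power_span (F L : fieldType) (iota : {rmorphism F -> L}) (y : L) :
  integralOver iota y -> exists N : nat, forall M, (N <= M)%N -> forall k, exists c : 'I_M -> F,
    y ^+ k = \sum_(s < M) iota (c s) * y ^+ s.
Proof.
case=> q qmon qy; exists (size q) => M qM k; exists (fun s => ('X^k %% q)`_s).
have -> : y ^+ k = (map_poly iota ('X^k %% q)).[y].
  rewrite -[LHS]hornerXn -(map_polyXn iota k) {1}(divp_eq 'X^k q).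
  by rewrite rmorphD rmorphM hornerD hornerM (eqP qy) mulr0 add0r.
rewrite (@horner_coef_wide _ M); first by apply: eq_bigr => s _; rewrite coef_map.
rewrite size_map_poly (leq_trans _ qM) // ltnW // ltn_modp monic_neq0 //.
Qed.

(** The monomials in the y_l with exponents below a common bound span: expand the
    product of the expressions of the powers of the y_l. *)
Lemma integral_gen_span (F0 F L : fieldType) (iota : {rmorphism F -> L})
    (j : {rmorphism F0 -> F}) (n : nat) (y : 'I_n -> L) :
  (forall l, integralOver iota (y l)) ->
  exists (m : nat) (u : 'I_m -> L), forall P : {mpoly F0[n]},
    exists a : 'I_m -> F, mmap (iota \o j) y P = \sum_t iota (a t) * u t.
Proof.
move=> yint.
have /choice[N NP] l := integral_power_span (yint l).
pose M := (\max_l N l)%N; pose T := {ffun 'I_n -> 'I_M}.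
exists #|T|, (fun t => \prod_l y l ^+ (enum_val t : T) l) => P.
have /choice[c cP] : forall lk : 'I_n * nat, exists c : 'I_M -> F,
    y lk.1 ^+ lk.2 = \sum_(s < M) iota (c s) * y lk.1 ^+ s.
  by case=> l k; apply: NP; rewrite /M (leq_bigmax l).
(* The coefficient of the monomial with exponents f, obtained by distributing
   the product over l of the expansions of the powers y_l^(m l). *)
pose a (f : T) : F := \sum_(m <- msupp P) j P@_m * \prod_l c (l, m l) (f l).
exists (fun t => a (enum_val t)).
rewrite -(reindex (@enum_val _ T) (P := xpredT)
   (F := fun f : T => iota (a f) * \prod_l y l ^+ f l)) /=; last first.
  by apply: onW_bij; apply: enum_val_bij.
under [RHS]eq_bigr => f _ do rewrite rmorph_sum mulr_suml.
rewrite exchange_big /=; apply: eq_bigr => m _.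
rewrite /mmap1 (eq_bigr (fun l => \sum_(s < M) iota (c (l, m l) s) * y l ^+ s)); last first.
  by move=> l _; rewrite -cP.
rewrite bigA_distr_bigA /= mulr_sumr; apply: eq_bigr => f _.
by rewrite big_split /= rmorphM rmorph_prod mulrA.
Qed.

(** The elements [w j], j < s, of C form a basis of Frac C over the subfield
    generated by the algebraically independent elements [G l], l < e; [iota] is the
    inclusion of this subfield. *)
Record frac_basis (F : fieldType) (C : idomainType) (i : {rmorphism F -> C})
    (e : nat) (G : nat -> C) (s : nat) (w : nat -> C)
    (iota : {rmorphism {fraction {mpoly F[e]}} -> {fraction C}}) : Prop := FracBasis {
  frac_basis_embed : forall P, iota P%:F = (peval i G e P)%:F;
  frac_basis_indep : lin_indep iota s (fun j => (w j)%:F);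
  frac_basis_span : forall b : C, exists a : nat -> {fraction {mpoly F[e]}},
    b%:F = \sum_(j < s) iota (a j) * (w j)%:F;
  frac_basis_algebraic : forall b, algebraic_elt (peval i G e) b }.

(** Enlarging the transcendental family makes the generators of C algebraic, so
    that C spans a finite dimensional space over the subfield; the h_j have stayed
    independent and extend to a basis of this space. *)
Theorem frac_basis_extension (F : fieldType) (C : idomainType) (i : {rmorphism F -> C})
    (n : nat) (y : 'I_n -> C) (d : nat) (g : nat -> C) (r : nat) (h : nat -> C) :
  (forall b, exists P : {mpoly F[n]}, b = mmap i y P) ->
  (0 < r)%N -> lin_indep (peval i g d) r h ->
  (forall j, (j < r)%N -> algebraic_elt (peval i g d) (h j)) ->
  exists e G s w iota, [/\ (d <= e)%N, forall l, (l < d)%N -> G l = g l,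
    (r <= s)%N, forall j, (j < r)%N -> w j = h j & @frac_basis F C i e G s w iota].
Proof.
move=> gen r0 ind0 alg0.
have [e [G [de Gg ind alg yalg]]] := transcendence_extension y r0 ind0 alg0.
have [iota iE] := frac_embed_exists r0 ind.
have yint l : integralOver iota (y l)%:F by apply/(algebraic_eltP iE).
pose j : {rmorphism F -> {fraction {mpoly F[e]}}} := @FracField.tofrac _ \o @mpolyC e F.
have jE c : iota (j c) = (i c)%:F by rewrite [LHS]iE; congr (_%:F); apply: pevalC.
have yE P : (mmap i y P)%:F = mmap (iota \o j) (fun l => (y l)%:F) P.
  rewrite rmorph_sum; apply: eq_bigr => m _; rewrite rmorphM /= -jE; congr (_ * _).
  by rewrite rmorph_prod; apply: eq_bigr => l _; rewrite rmorphXn.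
have [m [u uP]] := integral_gen_span j yint.
pose V (x : {fraction C}) := exists b, x = b%:F.
have Vsp x : V x -> exists a : 'I_m -> _, x = \sum_t iota (a t) * u t.
  by case=> b ->; have [P ->] := gen b; rewrite yE; apply: uP.
have [s [z [rs zh Vz indz spz]]] := lin_indep_extend_basis Vsp
  (fun j _ => ex_intro _ (h j) erefl) (lin_indep_frac iE ind).
have /choice[w wP] : forall l, exists b : C, (l < s)%N -> z l = b%:F.
  move=> l; have [ls|] := boolP (l < s)%N; last by exists 0.
  by have [b zb] := Vz l ls; exists b.
exists e, G, s, w, iota; split=> //.
  move=> l lr; apply/eqP; rewrite -tofrac_eq -wP ?zh //; exact: leq_trans lr rs.
split=> //.
- move=> a a0; apply: indz; rewrite -[RHS]a0; apply: eq_bigr => l _.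
  by rewrite wP.
- move=> b; have [a ->] := spz b%:F (ex_intro _ b erefl); exists a.
  by apply: eq_bigr => l _; rewrite wP.
- move=> b; apply/(algebraic_eltP iE); have [P ->] := gen b; rewrite yE.
  rewrite /mmap; elim/big_ind: _ => [|x x' ix ix'|k _]; first exact: integral0.
    exact: integral_add ix ix'.
  apply: integral_mul; first exact: integral_id.
  rewrite /mmap1; elim/big_ind: _ => [|x x' ix ix'|l _]; first exact: integral1.
    exact: integral_mul ix ix'.
  elim: (k l) => [|t IH]; first by rewrite expr0; apply: integral1.
  by rewrite exprS; exact: integral_mul (yint l) IH.
Qed.

(** * Tensor products over a field *)

Section Functionals.
Variables (k : fieldType) (A : comPzRingType) (iA : {rmorphism k -> A}).

Definition linear_functional (psi : A -> k) :=
  zmod_morphism psi /\ forall a c, psi (a * iA c) = psi a * c.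

Definition subspace (V : set A) :=
  [/\ V 0, forall x y, V x -> V y -> V (x + y) & forall x c, V x -> V (x * iA c)].

Lemma subspaceB V x y : subspace V -> V x -> V y -> V (x - y).
Proof.
case=> _ VD VZ Vx Vy; apply: VD => //.
by rewrite -[y]mulr1 -mulrN -(rmorph1 iA) -rmorphN; apply: VZ.
Qed.

(** Hahn-Banach without topology: by Zorn's lemma V extends to a subspace W that
    is maximal among those avoiding b. By maximality W and b span everything, and
    the functional is the coefficient along b. *)
Lemma separating_functional (V : set A) (b : A) :
  subspace V -> ~ V b ->
  exists psi, [/\ linear_functional psi, forall x, V x -> psi x = 0 & psi b = 1].
Proof.
move=> subV Vb; have [V0 VD VZ] := subV.
pose good W := [/\ subspace W, V `<=` W & ~ W b].
have [|W [gW maxW]] := @Zorn_bigcup _ [set W : set A | W = set0 \/ good W].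
  move=> F Fgood Ftot.
  have [[W0 FW0 nW0]|none] := pselect (exists2 W, F W & W <> set0); last first.
    left; apply/seteqP; split=> // x [W FW Wx].
    by case: none; exists W => // W0; rewrite W0 in Wx.
  have Fg W x : F W -> W x -> good W.
    by move=> FW Wx; case: (Fgood _ FW) => // W0'; rewrite W0' in Wx.
  have gW0 : good W0 by case: (Fgood _ FW0).
  right; split; last first.
  - by case=> W FW Wb; case: (Fg _ _ FW Wb).
  - by move=> x Vx; exists W0 => //; case: gW0 => _ + _; apply.
  split.
  - by exists W0 => //; case: gW0 => -[].
  - move=> x y [W FW Wx] [W' FW' Wy].
    have [s|s] := Ftot _ _ FW FW'.
      exists W' => //; have [[_ D _] _ _] := Fg _ _ FW' Wy.
      by apply: D => //; apply: s.
    exists W => //; have [[_ D _] _ _] := Fg _ _ FW Wx.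
    by apply: D => //; apply: s.
  - by move=> x c [W FW Wx]; exists W => //; have [[_ _ Z] _ _] := Fg _ _ FW Wx; apply: Z.
have {gW} gW : good W.
  case: gW => // W0; case: (maxW V); last by right; split.
  by rewrite W0 properEneq; split=> //; apply/eqP => e; rewrite -e in V0.
have [subW VW Wb] := gW; have [W0 WD WZ] := subW.
have dec x : exists c, W (x - b * iA c).
  have [Wx|Wx] := pselect (W x); first by exists 0; rewrite rmorph0 mulr0 subr0.
  (* If x were outside W and W + kx avoided b, then W would not be maximal. *)
  pose W' := [set z | exists y c, W y /\ z = y + x * iA c].
  have W'x : W' x by exists 0, 1; rewrite rmorph1 mulr1 add0r.
  have WW' : W `<=` W' by move=> y Wy; exists y, 0; rewrite rmorph0 mulr0 addr0.
  have [y [c [Wy bE]]] : W' b.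
    apply: contrapT => W'b; apply: (maxW W').
      by split=> // /(_ _ W'x).
    right; split=> //; last by move=> z /VW /WW'.
    split; first exact: WW'.
      move=> _ _ [y [c [Wy ->]]] [y' [c' [Wy' ->]]]; exists (y + y'), (c + c').
      by split; [exact: WD|rewrite rmorphD mulrDr addrACA].
    move=> _ c' [y [c [Wy ->]]]; exists (y * iA c'), (c * c').
    by split; [exact: WZ|rewrite rmorphM mulrDl mulrA].
  have c0 : c != 0.
    by apply: contra_notN Wb => /eqP c0; rewrite bE c0 rmorph0 mulr0 addr0.
  exists c^-1; rewrite bE mulrDl -mulrA -rmorphM mulfV // rmorph1 mulr1.
  rewrite opprD addrCA subrr addr0 -mulrN -rmorphN; exact: WZ.
have uniq x c c' : W (x - b * iA c) -> W (x - b * iA c') -> c = c'.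
  move=> Wc Wc'; apply/eqP; rewrite -subr_eq0; apply: contra_notT Wb => cc'.
  have := subspaceB subW Wc' Wc.
  have -> : x - b * iA c' - (x - b * iA c) = b * iA (c - c').
    by rewrite opprB addrC addrA subrK rmorphB mulrBr.
  move=> /(WZ _ (c - c')^-1).
  by rewrite -mulrA -rmorphM mulfV // rmorph1 mulr1.
have /choice[psi psiP] := dec.
exists psi; split.
- split=> [x y|a c]; apply: uniq (psiP _) _.
    have := subspaceB subW (psiP x) (psiP y); congr W.
    by rewrite rmorphB mulrBr !opprB addrACA [RHS]addrACA [- y - _]addrC.
  by rewrite rmorphM mulrA -mulrBl; apply: WZ.
- by move=> x Vx; apply: uniq (psiP x) _; rewrite rmorph0 mulr0 subr0; apply: VW.
- by apply: uniq (psiP b) _; rewrite rmorph1 mulr1 subrr.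
Qed.

Lemma separating_functional1 (b : A) : b != 0 ->
  exists psi, linear_functional psi /\ psi b = 1.
Proof.
move=> b0; have [||psi [h1 h2 h3]] := @separating_functional [set 0] b.
- by split=> // [x y -> ->|x c ->] /=; rewrite ?addr0 ?mul0r.
- by move=> e; rewrite e eqxx in b0.
- by exists psi.
Qed.

Lemma linear_functional0 psi : linear_functional psi -> psi 0 = 0.
Proof. by case=> + _ => /(_ 0 0); rewrite !subrr. Qed.

Lemma linear_functionalD psi a b : linear_functional psi -> psi (a + b) = psi a + psi b.
Proof.
move=> lpsi; have [B _] := lpsi.
have N x : psi (- x) = - psi x.
  by rewrite -[- x]add0r B linear_functional0 // sub0r.
by rewrite -[b in LHS]opprK B N opprK.
Qed.
End Functionals.

Section Contraction.
Variables (k : fieldType) (A B : comPzRingType).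
Variables (iA : {rmorphism k -> A}) (iB : {rmorphism k -> B}).
Implicit Types (psi : A -> k) (z : tensor iA iB).

(** The map a (x) b |-> psi(a) b. The maps out of the tensor product provided by
    [tensor_lift] are ring homomorphisms, while psi is only linear. *)
Definition contraction psi z : B :=
  \sum_(p <- repr z) iB (psi p.1) * p.2.

Lemma contraction_pi psi s : linear_functional iA psi ->
  contraction psi (\pi_(tensor iA iB)%qT s) = \sum_(p <- s) iB (psi p.1) * p.2.
Proof.
move=> lpsi; have [_ psiZ] := lpsi.
rewrite /contraction; have := tens_repr iA iB s; move: (repr _) => r.
elim=> {r s} //=.
- by move=> s t u _ -> _ ->.
- by move=> s s' t t' _ e _ e'; rewrite !big_cat /= e e'.
- by move=> s t; rewrite !big_cat /= addrC.
- by move=> b; rewrite big_seq1 big_nil /= (linear_functional0 lpsi) rmorph0 mul0r.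
- move=> a a' b; rewrite !big_cons !big_nil /= !addr0.
  by rewrite (linear_functionalD _ _ lpsi) rmorphD mulrDl.
- by move=> a b b'; rewrite !big_cons !big_nil /= !addr0 mulrDr.
- by move=> a c b; rewrite !big_seq1 /= psiZ rmorphM mulrA.
Qed.

Lemma contractionD psi : linear_functional iA psi ->
  {morph contraction psi : x y / x + y}.
Proof.
move=> lpsi; elim/tensorW=> s; elim/tensorW=> t.
by rewrite [X in contraction _ X]pi_tens_add !contraction_pi // big_cat.
Qed.

Lemma contraction_tens psi a b : linear_functional iA psi ->
  contraction psi (tens iA iB a b) = iB (psi a) * b.
Proof. by move=> lpsi; rewrite contraction_pi // big_seq1. Qed.

Lemma contraction_sum psi (I : Type) (s : seq I) (P : pred I) (F : I -> tensor iA iB) :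
  linear_functional iA psi ->
  contraction psi (\sum_(x <- s | P x) F x) = \sum_(x <- s | P x) contraction psi (F x).
Proof.
move=> lpsi; apply: big_morph; first exact: contractionD.
by rewrite [X in contraction _ X](_ : 0 = \pi_(tensor iA iB)%qT [::]) // contraction_pi ?big_nil.
Qed.

Lemma contraction0 psi : linear_functional iA psi -> contraction psi 0 = 0.
Proof.
move=> lpsi; have := contraction_sum [::] xpredT (fun _ : unit => 0) lpsi.
by rewrite !big_nil.
Qed.

Lemma tensor_sum z : exists (n : nat) (a : nat -> A) (b : nat -> B),
  z = \sum_(j < n) tens iA iB (a j) (b j).
Proof.
elim/tensorW: z => s; exists (size s), (fun j => (nth (0, 0) s j).1), (fun j => (nth (0, 0) s j).2).
by rewrite pi_sum (big_nth (0, 0)) big_mkord.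
Qed.

Lemma tens_morphl a : zmod_morphism (tens iA iB a).
Proof.
have D b b' : tens iA iB a (b + b') = tens iA iB a b + tens iA iB a b' by exact: tensDr.
by move=> b b'; apply: (addIr (tens iA iB a b')); rewrite -D !subrK.
Qed.

Lemma tensr0 a : tens iA iB a 0 = 0.
Proof. by have := tens_morphl a 0 0; rewrite !subrr. Qed.

Lemma tens0r b : tens iA iB 0 b = 0.
Proof. by apply: (addIr (tens iA iB 0 b)); rewrite -tensDl !add0r. Qed.

Lemma tens_suml b (I : Type) (s : seq I) (F : I -> A) :
  tens iA iB (\sum_(x <- s) F x) b = \sum_(x <- s) tens iA iB (F x) b.
Proof.
by apply: (big_morph (fun a => tens iA iB a b)) => [x y|]; [exact: tensDl|exact: tens0r].
Qed.

(** Induction on the length of an expression of z as a sum of a_j (x) b_j. If a_n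
    is a combination of the previous a_j, the n-th term is absorbed in the others;
    if not, a functional that is 1 at a_n and 0 at the other a_j shows b_n = 0. *)
Lemma tensor_eq0_contraction z :
  (forall psi, linear_functional iA psi -> contraction psi z = 0) -> z = 0.
Proof.
have [n [a [b ->]]] := tensor_sum z.
elim: n b => [|n IH] b z0; first by rewrite big_ord0.
pose V := [set x | exists c : nat -> k, x = \sum_(j < n) a j * iA (c j)].
have subV : subspace iA V.
  split; first by exists (fun=> 0); rewrite big1 // => j _; rewrite rmorph0 mulr0.
    move=> _ _ [c ->] [c' ->]; exists (fun j => c j + c' j).
    by rewrite -big_split; apply: eq_bigr => j _; rewrite /= rmorphD mulrDr.
  move=> _ c' [c ->]; exists (fun j => c j * c').
  by rewrite mulr_suml; apply: eq_bigr => j _; rewrite rmorphM mulrA.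
have [[c an]|Van] := pselect (V (a n)).
  have E : \sum_(j < n.+1) tens iA iB (a j) (b j) =
           \sum_(j < n) tens iA iB (a j) (b j + iB (c j) * b n).
    rewrite big_ord_recr /= an tens_suml -big_split; apply: eq_bigr => j _ /=.
    by rewrite tensDr tens_bal.
  by rewrite E; apply: (IH (fun j => b j + iB (c j) * b n)); rewrite -E.
have [psi [lpsi psi0 psi1]] := separating_functional subV Van.
have bn0 : b n = 0.
  have := z0 _ lpsi; rewrite contraction_sum // big_ord_recr /= contraction_tens //.
  rewrite psi1 rmorph1 mul1r big1 ?add0r // => j _.
  rewrite contraction_tens // psi0 ?rmorph0 ?mul0r //.
  exists (fun i => (i == j :> nat)%:R); rewrite (bigD1 j) //= eqxx rmorph1 mulr1 big1 ?addr0 //.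
  by move=> i /negbTE ij; rewrite val_eqE ij rmorph0 mulr0.
have E : \sum_(j < n.+1) tens iA iB (a j) (b j) = \sum_(j < n) tens iA iB (a j) (b j).
  by rewrite big_ord_recr /= bn0 tensr0 addr0.
by rewrite E; apply: IH; rewrite -E.
Qed.

Lemma contraction_scale psi z b : linear_functional iA psi ->
  contraction psi (tens iA iB 1 b * z) = b * contraction psi z.
Proof.
move=> lpsi; have [n [x [y ->]]] := tensor_sum z.
rewrite mulr_sumr !contraction_sum // mulr_sumr; apply: eq_bigr => j _.
by rewrite [X in contraction _ X]tensM !contraction_tens // mul1r mulrCA.
Qed.

End Contraction.

Lemma tens1_inj (k : fieldType) (A : comNzRingType) (B : comPzRingType)
    (iA : {rmorphism k -> A}) (iB : {rmorphism k -> B}) b :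
  tens iA iB 1 b = 0 -> b = 0.
Proof.
have [psi [lpsi psi1]] := separating_functional1 iA (oner_neq0 A).
move=> /(congr1 (contraction psi)); rewrite contraction_tens // psi1 rmorph1 mul1r => ->.
exact: contraction0.
Qed.

(** Contractions are B-linear and detect zero, and B is a domain. *)
Lemma tens1_nonzerodivisor (k : fieldType) (A : comPzRingType) (B : idomainType)
    (iA : {rmorphism k -> A}) (iB : {rmorphism k -> B}) (b : B) (z : tensor iA iB) :
  b != 0 -> tens iA iB 1 b * z = 0 -> z = 0.
Proof.
move=> b0 bz; apply: tensor_eq0_contraction => psi lpsi.
apply: (mulfI b0); rewrite -contraction_scale // bz mulr0.
exact: contraction0.
Qed.

(** * Injectivity of a base change as linear independence *)

(** A [frac_basis] with denominators cleared. It only involves evaluations of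
    polynomials, which makes sense after any base change of the coefficients. *)
Record poly_basis (F : fieldType) (C : idomainType) (i : {rmorphism F -> C})
    (d : nat) (t : nat -> C) (r : nat) (e : nat -> C) : Prop := PolyBasis {
  poly_basis_gt0 : (0 < r)%N;
  poly_basis_indep : lin_indep (peval i t d) r e;
  poly_basis_span : forall b, exists c : {mpoly F[d]}, c != 0 /\
    exists a : nat -> {mpoly F[d]},
      peval i t d c * b = \sum_(j < r) peval i t d (a j) * e j;
  poly_basis_algebraic : forall b, algebraic_elt (peval i t d) b }.

(** Extend the empty transcendental family and the independent family 1. *)
Lemma poly_basis_exists (F : fieldType) (C : idomainType) (i : {rmorphism F -> C}) :
  finitely_generated i -> exists d t r e, poly_basis i d t r e.
Proof.
case=> n [y gen].
have [|||d [t [r [e [iota [_ _ r0 _ [iE ind span alg]]]]]]] :=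
  @frac_basis_extension F C i n y 0 (fun=> 0) 1 (fun=> 1) gen.
- by [].
- move=> a; rewrite big_ord1 mulr1 (mpoly0_const (a _)) pevalC => /eqP.
  rewrite fmorph_eq0 => /eqP a0 [] // _.
  by rewrite (mpoly0_const (a _)) a0 mpolyC0.
- move=> j _; exists ('X - 1%:P); first by rewrite polyXsubC_eq0.
  by rewrite rmorphB /= map_polyX map_polyC /= rmorph1 root_XsubC.
exists d, t, r, e; split=> //; first exact: lin_indep_of_frac ind.
move=> b; have [x bx] := span b; have [c [c0 [a ca]]] := frac_common_denom x r.
exists c; split=> //; exists a; apply/eqP; rewrite -tofrac_eq; apply/eqP.
rewrite rmorphM /= -iE bx mulr_sumr [RHS]rmorph_sum; apply: eq_bigr => j _.
by rewrite [in RHS]rmorphM /= -iE -ca // rmorphM mulrA.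
Qed.

Section Residue.
Variables (R : idomainType) (p : Spec R).

Lemma to_residue_eq0 a : (to_residue p a == 0) = (a \in (p : {pred R})).
Proof.
have -> : (0 : residue_field p) = \pi_(residue_field p)%qT 0 by rewrite rmorph0.
rewrite /to_residue -Quotient.idealrBE subr0.
apply/asboolP/idP => [[b [s [bp sp /= e]]]|ap]; last first.
  by exists a, 1; split=> //=; [exact: notin_prime1|rewrite tofrac1 divr1].
have : a * s = b.
  apply/eqP; rewrite -tofrac_eq rmorphM /= e divfK //; exact: notin_prime_neq0 sp.
by move=> asb; rewrite -asb prime_idealrM (negbTE sp) orbF in bp.
Qed.

Lemma to_residue_neq0 a : (a \notin (p : {pred R})) -> to_residue p a != 0.
Proof. by rewrite to_residue_eq0. Qed.

Lemma residue_fracE (x : residue_field p) :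
  exists a s, s \notin (p : {pred R}) /\ x = to_residue p a / to_residue p s.
Proof.
elim/quotW: x => x; have /asboolP[a [s [sp ex]]] := valP x.
exists a, s; split=> //; apply: (mulIf (to_residue_neq0 sp)).
rewrite divfK ?to_residue_neq0 // /to_residue -rmorphM; congr (\pi_(residue_field p)%qT _).
by apply: val_inj; rewrite /= ex divfK // (notin_prime_neq0 sp).
Qed.

Lemma residue_common_denom (x : nat -> residue_field p) (n : nat) :
  exists s, s \notin (p : {pred R}) /\ exists a : nat -> R,
    forall j, (j < n)%N -> to_residue p s * x j = to_residue p (a j).
Proof.
have [|a b||j|c c0 cP] := @common_multiplier R (fun c => c \notin (p : {pred R}))
    (fun j c => exists a, to_residue p c * x j = to_residue p a) _ _ _ _ n.
- exact: notin_prime1.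
- exact: notin_primeM.
- by move=> j a b [a' e]; exists (b * a'); rewrite rmorphM -mulrA e -rmorphM.
- have [m [c [c0 ->]]] := residue_fracE (x j); exists c => //; exists m.
  by rewrite mulrC divfK // to_residue_neq0.
exists c; split=> //.
have /choice[a aP] : forall j, exists a, (j < n)%N -> to_residue p c * x j = to_residue p a.
  move=> j; have [/cP[a e]|jr] := boolP (j < n)%N; first by exists a.
  by exists 0.
by exists a.
Qed.
End Residue.

(** With K the residue field at p and [phi] the map Psi^p, this is the condition
    on p that replaces injectivity of the fibre map. *)
Definition base_change_indep (K : fieldType) (B C : idomainType) (iC : {rmorphism K -> C})
    (phi : B -> C) (d : nat) (t : nat -> B) (r : nat) (e : nat -> B) : Prop :=
  lin_indep (peval iC (fun l => phi (t l)) d) r (fun j => phi (e j)).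

Section InjectivityCriterion.
Variables (k K : fieldType) (B C : idomainType).
Variables (iK : {rmorphism k -> K}) (iB : {rmorphism k -> B}).
Variables (iC : {rmorphism K -> C}) (phi : {rmorphism B -> C}).
Hypothesis phi_k : forall c : k, iC (iK c) = phi (iB c).

Lemma tensor_lift_rmorphism :
  exists f : {rmorphism tensor iK iB -> C}, f =1 tensor_lift iC phi.
Proof.
pose f : {rmorphism tensor iK iB -> C} := HB.pack (tensor_lift (iA := iK) (iB := iB) iC phi)
  (GRing.isZmodMorphism.Build _ _ _ (tensor_lift_zmod_morphism phi_k))
  (GRing.isMonoidMorphism.Build _ _ _ (tensor_lift_monoid_morphism phi_k)).
by exists f.
Qed.

Lemma rmorph_peval_base_change d (t : nat -> B) (Q : {mpoly k[d]}) :
  phi (peval iB t d Q) = peval iC (fun l => phi (t l)) d (map_mpoly iK Q).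
Proof.
by rewrite peval_map peval_rmorph; apply: eq_peval_coef => c /=.
Qed.

Variables (d : nat) (t : nat -> B) (r : nat) (e : nat -> B).
Hypothesis basis : poly_basis iB d t r e.

(** The t^m e_j are independent over k in B, so the t^m e_j in K (x) B are
    independent over K: contracting a relation by functionals of K yields relations
    over k. A relation between the images thus comes from a nonzero element of the
    kernel. *)
Lemma tensor_lift_inj_indep :
  injective (tensor_lift (iA := iK) (iB := iB) iC phi) ->
  base_change_indep iC phi d t r e.
Proof.
have [f fE] := tensor_lift_rmorphism.
move=> inj P P0 j0 j0r; apply/mpolyP => m0; rewrite mcoeff0.
apply: contrapT => /eqP c0.
have [psi [lpsi psi1]] := separating_functional1 iK c0.
pose z : tensor iK iB := \sum_(j < r) \sum_(m <- msupp (P j))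
  tens iK iB (P j)@_m (mmap1 (fun l : 'I_d => t l) m * e j).
have z0 : z = 0.
  apply: inj; rewrite -!fE raddf0 -[RHS]P0.
  rewrite raddf_sum; apply: eq_bigr => j _; rewrite raddf_sum mulr_suml.
  apply: eq_bigr => m _; rewrite /= fE tensor_lift_tens // -mulrA; congr (_ * _).
  rewrite rmorphM; congr (_ * _); rewrite rmorph_prod.
  by apply: eq_bigr => l _; rewrite rmorphXn.
(* Applying psi to the coefficients of P_j gives a relation over k. *)
pose Q j : {mpoly k[d]} := \sum_(m <- msupp (P j)) psi (P j)@_m *: 'X_[m].
have QE j m : m \in msupp (P j) -> (Q j)@_m = psi (P j)@_m.
  move=> mP; rewrite raddf_sum (bigD1_seq m) ?msupp_uniq //= mcoeffZ mcoeffX eqxx mulr1.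
  rewrite big1 ?addr0 // => m' /negbTE mm'.
  by rewrite mcoeffZ mcoeffX mm' mulr0.
have : contraction psi z = 0 by rewrite z0 contraction0.
have -> : contraction psi z = \sum_(j < r) peval iB t d (Q j) * e j.
  rewrite contraction_sum //; apply: eq_bigr => j _; rewrite contraction_sum // rmorph_sum mulr_suml.
  apply: eq_bigr => m _; rewrite contraction_tens // mulrA; congr (_ * _).
  by rewrite -mul_mpolyC rmorphM /= pevalC /peval mmapX.
move=> e0; have := @poly_basis_indep _ _ _ _ _ _ _ basis Q e0 j0 j0r.
move=> /(congr1 (fun Q => Q@_m0)).
rewrite mcoeff0 QE ?psi1 ?mcoeff_msupp //; apply/eqP; exact: oner_neq0.
Qed.

(** Given z in the kernel, some nonzero c(t) makes (1 (x) c(t)) z a combination of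
    the t^m e_j. Independence of the images kills its coefficients, so this product
    is 0, and then z = 0 by [tens1_nonzerodivisor]. *)
Lemma tensor_lift_indep_inj :
  base_change_indep iC phi d t r e ->
  injective (tensor_lift (iA := iK) (iB := iB) iC phi).
Proof.
have [f fE] := tensor_lift_rmorphism.
move=> ind; apply: (eq_inj _ fE); apply: raddf_inj => z fz.
have [n [lam [b zE]]] := tensor_sum z.
have [c c0 cP] : exists2 c : {mpoly k[d]}, c != 0 & forall i, (i < n)%N ->
    exists a : nat -> {mpoly k[d]},
      peval iB t d c * b i = \sum_(j < r) peval iB t d (a j) * e j.
  apply: common_multiplier => [|||i]; first exact: oner_neq0.
  - exact: mulf_neq0.
  - move=> i c c' [a ca]; exists (fun j => c' * a j).
    rewrite rmorphM -mulrA ca mulr_sumr; apply: eq_bigr => j _.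
    by rewrite rmorphM mulrA.
  - by have [c [c0 [a ca]]] := poly_basis_span basis (b i); exists c => //; exists a.
have /choice[a ca] : forall i, exists a : nat -> {mpoly k[d]}, (i < n)%N ->
    peval iB t d c * b i = \sum_(j < r) peval iB t d (a j) * e j.
  move=> i; have [/cP[a ca]|ni] := boolP (i < n)%N; first by exists a.
  by exists (fun=> 0).
have tc0 : peval iB t d c != 0.
  by rewrite (raddf_eq0 _ (lin_indep_inj (poly_basis_gt0 basis) (poly_basis_indep basis))).
apply: (tens1_nonzerodivisor tc0).
pose P j : {mpoly K[d]} := \sum_(i < n) lam i *: map_mpoly iK (a i j).
have zE' : tens iK iB 1 (peval iB t d c) * z =
    \sum_(i < n) tens iK iB (lam i) (\sum_(j < r) peval iB t d (a i j) * e j).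
  rewrite zE mulr_sumr; apply: eq_bigr => i _.
  by rewrite tensM mul1r ca.
have P0 j : (j < r)%N -> P j = 0.
  apply: ind; have : f (tens iK iB 1 (peval iB t d c) * z) = 0 by rewrite rmorphM fz mulr0.
  rewrite zE' rmorph_sum => e0; rewrite -[RHS]e0.
  under [RHS]eq_bigr => i _ do rewrite fE tensor_lift_tens // rmorph_sum mulr_sumr.
  rewrite exchange_big; apply: eq_bigr => j' _ /=; rewrite /P rmorph_sum mulr_suml.
  apply: eq_bigr => i _; rewrite -mul_mpolyC rmorphM /= pevalC -mulrA; congr (_ * _).
  by rewrite rmorphM rmorph_peval_base_change.
apply: tensor_eq0_contraction => psi lpsi; rewrite zE' contraction_sum //.
have [_ psiZ] := lpsi.
under eq_bigr => i _ do rewrite contraction_tens // mulr_sumr.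
rewrite exchange_big big1 //= => j _.
have -> : \sum_(i < n) iB (psi (lam i)) * (peval iB t d (a i j) * e j) =
   peval iB t d (\sum_(i < n) psi (lam i) *: a i j) * e j.
  rewrite rmorph_sum mulr_suml; apply: eq_bigr => i _.
  by rewrite -mul_mpolyC rmorphM /= pevalC mulrA.
rewrite (_ : \sum_(i < n) _ = 0) ?rmorph0 ?mul0r //; apply/mpolyP => m.
rewrite mcoeff0 raddf_sum /=.
have := congr1 (fun Q => psi Q@_m) (P0 j (ltn_ord j)).
rewrite mcoeff0 (linear_functional0 lpsi) raddf_sum /= => e0; rewrite -[RHS]e0.
rewrite (big_morph psi (fun x y => linear_functionalD x y lpsi) (linear_functional0 lpsi)).
by apply: eq_bigr => i _; rewrite !mcoeffZ mcoeff_map_mpoly psiZ.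
Qed.
End InjectivityCriterion.

Lemma inj_locusP (k : fieldType) (R B : idomainType)
    (iR : {rmorphism k -> R}) (iB : {rmorphism k -> B})
    (N : nat) (Psi : {rmorphism B -> {mpoly R[N]}})
    (Psi_k : forall c : k, Psi (iB c) = (iR c)%:MP_[N])
    (d : nat) (t : nat -> B) (r : nat) (e : nat -> B) (p : Spec R) :
  poly_basis iB d t r e ->
  inj_locus iR iB Psi p <->
  @base_change_indep (residue_field p) B {mpoly (residue_field p)[N]}
    (@mpolyC N (residue_field p)) (Psi_at Psi p) d t r e.
Proof.
move=> basis.
have Psi_kp c : @mpolyC N _ ((to_residue p \o iR) c) = Psi_at Psi p (iB c).
  by rewrite /= Psi_k map_mpolyC.
split=> H.
  exact: (tensor_lift_inj_indep Psi_kp basis H).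
exact: (tensor_lift_indep_inj Psi_kp basis H).
Qed.

(** * Independence with bounded coefficients is open *)

Lemma row_free_minorP (F : fieldType) (m n : nat) (A : 'M[F]_(m, n)) :
  row_free A <-> exists f : 'I_m -> 'I_n, \det (colsub f A) != 0.
Proof.
split=> [Afree|[f fdet]].
  have full : row_full A^T by rewrite /row_full mxrank_tr.
  exists (fullrankfun full); rewrite -det_tr -unitfE -[_ \is a _]/(_ \in unitmx).
  have -> : (colsub (fullrankfun full) A)^T = rowsub (fullrankfun full) A^T.
    by apply/matrixP => i j; rewrite !mxE.
  exact: fullrowsub_unit.
have fu : colsub f A \in unitmx by rewrite unitmxE unitfE.
rewrite -kermx_eq0; apply/eqP/row_matrixP => i; rewrite row0.
apply: (can_inj (mulmxK fu)); rewrite mul0mx mulmx_colsub -row_mul mulmx_ker.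
by apply/rowP => x; rewrite !mxE.
Qed.

(** Independence means that some maximal minor of the matrix of coefficients,
    which has entries in R, is nonzero in the residue field, that is, not in p. *)
Lemma open_lin_indep (R : idomainType) (N : nat) (I : finType) (v : I -> {mpoly R[N]}) :
  open [set p : Spec R | forall lam : I -> residue_field p,
    \sum_i lam i *: map_mpoly (to_residue p) (v i) = 0 -> forall i, lam i = 0].
Proof.
pose K := (\max_i msize (v i))%N; pose J : finType := 'X_{1..N < K}.
pose M := \matrix_(s < #|I|, t < #|J|) (v (enum_val s))@_(enum_val t : J).
rewrite zariski_openE; exists [set x | exists f, x = \det (colsub f M)].
have vE p i : map_mpoly (to_residue p) (v i) =
    \sum_(t < #|J|) to_residue p (M (enum_rank i) t) *: 'X_[(enum_val t : J)].
  rewrite {1}(mpolywE (k := K) (p := v i)); last exact: (leq_bigmax i).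
  rewrite rmorph_sum (reindex (@enum_val _ J)) /=; last first.
    by apply: onW_bij; apply: enum_val_bij.
  by apply: eq_bigr => t _; rewrite map_mpolyZ map_mpolyX mxE enum_rankK.
have relE p (lam : I -> residue_field p) :
    (\sum_i lam i *: map_mpoly (to_residue p) (v i) == 0) =
    ((\row_s lam (enum_val s)) *m map_mx (to_residue p) M == 0).
  have coefE (t : 'I_#|J|) : (\sum_i lam i *: map_mpoly (to_residue p) (v i))@_(enum_val t : J) =
      ((\row_s lam (enum_val s)) *m map_mx (to_residue p) M) 0 t.
    rewrite mxE raddf_sum (reindex (@enum_val _ I)) /=; last first.
      by apply: onW_bij; apply: enum_val_bij.
    by apply: eq_bigr => s _; rewrite mcoeffZ mcoeff_map_mpoly !mxE.
  apply/eqP/eqP => e.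
    by apply/rowP => t; rewrite -coefE e mcoeff0 mxE.
  under eq_bigr => i _ do rewrite vE scaler_sumr.
  rewrite exchange_big big1 //= => t _.
  have := congr1 (fun X : 'rV__ => X 0 t) e; rewrite !mxE => e0.
  under eq_bigr => i _ do rewrite scalerA.
  rewrite -scaler_suml (_ : \sum_i _ = 0) ?scale0r // -[RHS]e0.
  rewrite (reindex (@enum_val _ I)) /=; last first.
    by apply: onW_bij; apply: enum_val_bij.
  by apply: eq_bigr => s _; rewrite enum_valK !mxE.
apply/seteqP; split=> p /=.
  move=> ind; apply/existsNP.
  have /row_free_minorP[f fdet] : row_free (map_mx (to_residue p) M).
    rewrite -kermx_eq0; apply: contrapT => /negP/rowV0Pn[u /sub_kermxP uM]; case/negP.
    have uE : \row_s u 0 (enum_rank (enum_val s)) = u.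
      by apply/rowP => s; rewrite mxE enum_valK.
    apply/eqP/rowP => s; rewrite mxE -(enum_valK s).
    apply: (ind (fun i => u 0 (enum_rank i))).
    by apply/eqP; rewrite relE uE uM.
  exists (\det (colsub f M)); apply/not_implyP; split; first by exists f.
  by apply/negP; rewrite -to_residue_eq0 -det_map_mx map_mxsub.
move=> /existsNP[_ /not_implyP[[f ->] /negP]].
rewrite -to_residue_eq0 -det_map_mx map_mxsub => fdet lam /eqP.
have /row_free_inj fr : row_free (map_mx (to_residue p) M) by apply/row_free_minorP; exists f.
rewrite relE -(mul0mx _ (map_mx (to_residue p) M)) => /eqP/fr e i.
by have := congr1 (fun X : 'rV__ => X 0 (enum_rank i)) e; rewrite !mxE enum_rankK.
Qed.

(** * Limits of primes and the spreading of relations *)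

(** Convergence in the constructible topology of the spectrum. *)
Definition spec_limit (R : comNzRingType) (U : set_system (Spec R)) (q : Spec R) :=
  (forall a, a \in (q : {pred R}) -> U [set p : Spec R | a \in (p : {pred R})]) /\
  (forall a, a \notin (q : {pred R}) -> U [set p : Spec R | a \notin (p : {pred R})]).

(** Compactness of the constructible topology: the elements that belong to almost
    all primes form a prime, since an ultrafilter containing a union of two sets
    contains one of them. *)
Lemma ultrafilter_spec_limit (R : comNzRingType) (U : set_system (Spec R)) :
  UltraFilter U -> exists q, spec_limit U q.
Proof.
move=> UU; pose S : {pred R} := fun a => `[< U [set p : Spec R | a \in (p : {pred R})] >].
have SI : idealr_closed S.
  split.
  - by apply/asboolP; apply: filterS filterT => p _; exact: idealr0.
  - apply/negP => /asboolP H; apply: (@filter_not_empty _ U).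
    by apply: filterS H => p /=; rewrite idealr1.
  - move=> a u v /asboolP Hu /asboolP Hv; apply/asboolP.
    apply: filterS (filterI Hu Hv) => p [/= up vp].
    by rewrite rpredD // idealMr.
have SP : prime_idealr_closed S.
  move=> u v /asboolP Huv; apply/orP.
  have [Hu|Hu] := in_ultra_setVsetC [set p : Spec R | u \in (p : {pred R})] UU.
    by left; apply/asboolP.
  right; apply/asboolP; apply: filterS (filterI Huv Hu) => p [/=].
  by rewrite prime_idealrM => /orP[].
pose q : Spec R := HB.pack S (isIdealr.Build R S SI) (isPrimeIdealrClosed.Build R S SP).
exists q; split=> a; first by move=> /asboolP.
move=> aq; have [Ha|//] := in_ultra_setVsetC [set p : Spec R | a \in (p : {pred R})] UU.
  by case/asboolP: aq.
by apply: filterS => p /negP.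
Qed.

Section Spreading.
Variables (R : idomainType) (U : set_system (Spec R)) (q : Spec R).
Hypotheses (FU : Filter U) (Uq : spec_limit U q).

(** Only finitely many coefficients have to lie in p. *)
Lemma near_map_mpoly_eq0 n (W : {mpoly R[n]}) :
  map_mpoly (to_residue q) W = 0 ->
  U [set p : Spec R | map_mpoly (to_residue p) W = 0].
Proof.
move=> W0.
have := filter_forall (F := U) (f := fun s : 'I_(size (msupp W)) =>
  [set p : Spec R | W@_(nth 0%MM (msupp W) s) \in (p : {pred R})]) FU.
move=> /(_ _) H; apply: filterS (H _) => [p /= Hp|s].
  apply/mpolyP => m; rewrite mcoeff_map_mpoly mcoeff0.
  have [mW|/memN_msupp_eq0 ->] := boolP (m \in msupp W); last by rewrite /= raddf0.
  apply/eqP; rewrite to_residue_eq0.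
  have ms : (index m (msupp W) < size (msupp W))%N by rewrite index_mem.
  by have := Hp (Ordinal ms); rewrite /= nth_index.
apply: (proj1 Uq); rewrite -to_residue_eq0 -mcoeff_map_mpoly W0.
by rewrite mcoeff0.
Qed.

Lemma near_map_mpoly_neq0 n (W : {mpoly R[n]}) :
  map_mpoly (to_residue q) W != 0 ->
  U [set p : Spec R | map_mpoly (to_residue p) W != 0].
Proof.
move=> W0.
have [m Wm] : exists m, W@_m \notin (q : {pred R}).
  apply: contrapT => H; case/eqP: W0; apply/mpolyP => m.
  rewrite mcoeff_map_mpoly mcoeff0; apply/eqP; rewrite to_residue_eq0.
  by apply: contrapT => /negP Wm; apply: H; exists m.
apply: filterS (proj2 Uq _ Wm) => p /= Wp.
apply: contra Wp => /eqP Wp0; rewrite -to_residue_eq0 -mcoeff_map_mpoly Wp0.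
by rewrite mcoeff0.
Qed.
End Spreading.

Lemma lift_residue_mpoly (R : idomainType) (p : Spec R) n (P : {mpoly (residue_field p)[n]}) :
  exists2 s, s \notin (p : {pred R}) &
    exists Q : {mpoly R[n]}, to_residue p s *: P = map_mpoly (to_residue p) Q.
Proof.
have [s [sp [a aP]]] :=
  residue_common_denom (fun l => P@_(nth 0%MM (msupp P) l)) (size (msupp P)).
exists s => //; exists (\sum_(l < size (msupp P)) a l *: 'X_[nth 0%MM (msupp P) l]).
rewrite [in LHS](mpolyE P) (big_nth 0%MM) big_mkord scaler_sumr rmorph_sum.
by apply: eq_bigr => l _ /=; rewrite map_mpolyZ map_mpolyX scalerA aP.
Qed.

Lemma lift_residue_mpolys (R : idomainType) (p : Spec R) n
    (P : nat -> {mpoly (residue_field p)[n]}) r :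
  exists2 s, s \notin (p : {pred R}) & exists Q : nat -> {mpoly R[n]},
    forall j, (j < r)%N -> to_residue p s *: P j = map_mpoly (to_residue p) (Q j).
Proof.
have [|||j|c c0 cP] := @common_multiplier R (fun c => c \notin (p : {pred R}))
    (fun j c => exists Q, to_residue p c *: P j = map_mpoly (to_residue p) Q) _ _ _ _ r.
- exact: notin_prime1.
- exact: notin_primeM.
- by move=> j a b [Q e]; exists (b *: Q); rewrite rmorphM -scalerA e map_mpolyZ.
- exact: lift_residue_mpoly.
exists c => //.
have /choice[Q QP] : forall j, exists Q, (j < r)%N ->
    to_residue p c *: P j = map_mpoly (to_residue p) Q.
  move=> j; have [/cP[Q e]|jr] := boolP (j < r)%N; first by exists Q.
  by exists 0.
by exists Q.
Qed.

Lemma msize_le_coef (F : nzRingType) n (P : {mpoly F[n]}) D :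
  (forall m, (D <= mdeg m)%N -> P@_m = 0) -> (msize P <= D)%N.
Proof.
move=> H; rewrite msizeE; apply/bigmax_leqP_seq => m mP _.
by rewrite ltnNge; apply: contraL mP => /H m0; rewrite mcoeff_msupp m0 eqxx.
Qed.

Section BoundedRelations.
Variables (K : fieldType) (B : idomainType) (N : nat).
Variables (phi : {rmorphism B -> {mpoly K[N]}}).
Variables (d : nat) (t : nat -> B) (r : nat) (e : nat -> B).

Definition base_change_indep_below (D : nat) : Prop :=
  forall P : nat -> {mpoly K[d]}, (forall j m, (D <= mdeg m)%N -> (P j)@_m = 0) ->
    \sum_(j < r) peval (@mpolyC N K) (fun l => phi (t l)) d (P j) * phi (e j) = 0 ->
    forall j, (j < r)%N -> P j = 0.

(** Restates the condition for the finite family of the t^m e_j with m of degree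
    less than D, to which [open_lin_indep] applies. *)
Lemma base_change_indep_belowP D : base_change_indep_below D <->
  (forall lam : 'I_r * 'X_{1..d < D} -> K,
    \sum_i lam i *: phi (mmap1 (fun l : 'I_d => t l) i.2 * e i.1) = 0 ->
    forall i, lam i = 0).
Proof.
have relE (lam : 'I_r * 'X_{1..d < D} -> K) (P : nat -> {mpoly K[d]}) :
    (forall j : 'I_r, P j = \sum_m lam (j, m) *: 'X_[m]) ->
    \sum_i lam i *: phi (mmap1 (fun l : 'I_d => t l) i.2 * e i.1) =
    \sum_(j < r) peval (@mpolyC N K) (fun l => phi (t l)) d (P j) * phi (e j).
  move=> PE; rewrite (eq_bigr (fun i => lam (i.1, i.2) *:
    phi (mmap1 (fun l : 'I_d => t l) (i.1, i.2).2 * e (i.1, i.2).1))); last by case.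
  rewrite -(pair_bigA _ (fun j m => lam (j, m) *: phi (mmap1 (fun l : 'I_d => t l) m * e j))) /=.
  apply: eq_bigr => j _; rewrite PE rmorph_sum mulr_suml.
  apply: eq_bigr => m _; rewrite -!mul_mpolyC [in RHS]rmorphM /= pevalC -mulrA; congr (_ * _).
  rewrite rmorphM; congr (_ * _); rewrite /peval mmapX rmorph_prod.
  by apply: eq_bigr => l _; rewrite rmorphXn.
split=> ind.
  move=> lam; pose P j := if insub j is Some j' then \sum_m lam (j', m) *: 'X_[m] else 0.
  have PE (j : 'I_r) : P j = \sum_m lam (j, m) *: 'X_[m] by rewrite /P valK.
  rewrite (relE lam P PE) => /ind H [j m].
  have /(_ _) := H _ j (ltn_ord j) => /(_ _)/(congr1 (fun Q => Q@_m)).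
  rewrite PE mcoeff0 raddf_sum (bigD1 m) //= mcoeffZ mcoeffX eqxx mulr1 big1 ?addr0; first apply.
    move=> j' m' Dm; rewrite /P; case: insubP => [j'' _ _|]; last by rewrite mcoeff0.
    rewrite raddf_sum big1 // => m'' _; rewrite /= mcoeffZ mcoeffX.
    case: eqP => [mm|]; last by rewrite mulr0.
    by have := bmdeg m''; rewrite mm ltnNge Dm.
  move=> m' /negbTE mm'; rewrite mcoeffZ mcoeffX.
  by rewrite (inj_eq val_inj) mm' mulr0.
move=> P degP P0 j jr.
have PE (l : 'I_r) : P l = \sum_(m : 'X_{1..d < D}) (P l)@_m *: 'X_[m].
  by apply: mpolywE; apply: msize_le_coef => m; apply: degP.
rewrite -[j]/(val (Ordinal jr)) PE big1 // => m _.
have := ind (fun x => (P x.1)@_x.2); rewrite (relE _ P PE) P0.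
by move=> /(_ erefl (Ordinal jr, m)) /= ->; rewrite scale0r.
Qed.

Lemma base_change_indep_below_all D :
  base_change_indep (@mpolyC N K) phi d t r e -> base_change_indep_below D.
Proof. by move=> ind P _; apply: ind. Qed.

Lemma base_change_indep_below_le D D' : (D <= D')%N ->
  base_change_indep_below D' -> base_change_indep_below D.
Proof.
move=> DD ind P degP; apply: ind => j m Dm; apply: degP; exact: leq_trans Dm.
Qed.

Lemma not_base_change_indep : ~ base_change_indep (@mpolyC N K) phi d t r e ->
  exists (P : nat -> {mpoly K[d]}) (j0 : nat), [/\ (j0 < r)%N, P j0 != 0 &
    \sum_(j < r) peval (@mpolyC N K) (fun l => phi (t l)) d (P j) * phi (e j) = 0].
Proof.
move=> /existsNP[P /not_implyP[P0 /existsNP[j0 /not_implyP[j0r Pj0]]]].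
by exists P, j0; split=> //; apply/eqP.
Qed.

Lemma relation_scale (c : K) (P Q : nat -> {mpoly K[d]}) :
  (forall j, (j < r)%N -> c *: P j = Q j) ->
  \sum_(j < r) peval (@mpolyC N K) (fun l => phi (t l)) d (P j) * phi (e j) = 0 ->
  \sum_(j < r) peval (@mpolyC N K) (fun l => phi (t l)) d (Q j) * phi (e j) = 0.
Proof.
move=> PQ P0; rewrite -[RHS](mulr0 c%:MP) -[in RHS]P0 mulr_sumr.
by apply: eq_bigr => j _; rewrite -PQ // -mul_mpolyC rmorphM /= pevalC mulrA.
Qed.
End BoundedRelations.

Section Relations.
Variables (R B : idomainType) (N : nat) (Psi : {rmorphism B -> {mpoly R[N]}}).
Variables (d : nat) (t : nat -> B) (r : nat) (e : nat -> B).

Definition fiber_indep (p : Spec R) : Prop :=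
  @base_change_indep (residue_field p) B {mpoly (residue_field p)[N]}
    (@mpolyC N (residue_field p)) (Psi_at Psi p) d t r e.

Definition fiber_indep_below (D : nat) : set (Spec R) :=
  [set p | @base_change_indep_below (residue_field p) B N (Psi_at Psi p) d t r e D].

Lemma open_fiber_indep_below D : open (fiber_indep_below D).
Proof.
have := @open_lin_indep R N ('I_r * 'X_{1..d < D})%type
  (fun i => Psi (mmap1 (fun l : 'I_d => t l) i.2 * e i.1)).
congr (open _); apply/seteqP; split=> p /=.
  by move=> H; apply/base_change_indep_belowP.
by move/base_change_indep_belowP.
Qed.

Lemma peval_reduction (p : Spec R) (Q : {mpoly R[d]}) :
  peval (@mpolyC N (residue_field p)) (fun l => Psi_at Psi p (t l)) d
    (map_mpoly (to_residue p) Q) =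
  map_mpoly (to_residue p) (peval (@mpolyC N R) (fun l => Psi (t l)) d Q).
Proof.
rewrite peval_map peval_rmorph; apply: eq_peval_coef => c.
exact: esym (map_mpolyC _ _ c).
Qed.

(** Clear the denominators of a relation at q: it lifts to a relation over R whose
    finitely many coefficients vanish at q, hence at almost all p, while some
    nonzero coefficient of the P_j stays nonzero at almost all p. *)
Lemma dependence_spreads (U : set_system (Spec R)) (q : Spec R) :
  Filter U -> spec_limit U q -> ~ fiber_indep q -> exists D, U (~` fiber_indep_below D).
Proof.
move=> FU Uq /not_base_change_indep[P [j0 [j0r Pj0 P0]]].
have [s sq [Q QP]] := lift_residue_mpolys P r.
pose D := (\max_(j < r) msize (Q j))%N; exists D.
pose W := \sum_(j < r) peval (@mpolyC N R) (fun l => Psi (t l)) d (Q j) * Psi (e j).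
have WE p : map_mpoly (to_residue p) W =
    \sum_(j < r) peval (@mpolyC N (residue_field p)) (fun l => Psi_at Psi p (t l)) d
      (map_mpoly (to_residue p) (Q j)) * Psi_at Psi p (e j).
  rewrite /W rmorph_sum; apply: eq_bigr => j _; rewrite rmorphM /=.
  by rewrite peval_reduction.
have W0 : map_mpoly (to_residue q) W = 0.
  by rewrite WE; apply: relation_scale QP P0.
have Q0 : map_mpoly (to_residue q) (Q j0) != 0.
  rewrite -QP // -mul_mpolyC; apply: mulf_neq0; last exact: Pj0.
  by rewrite mpolyC_eq0 to_residue_neq0.
apply: filterS (filterI (near_map_mpoly_eq0 FU Uq W0) (near_map_mpoly_neq0 FU Uq Q0)).
move=> p [/= Wp Qp] ind.
case/eqP: Qp.
have := ind (fun j => if (j < r)%N then map_mpoly (to_residue p) (Q j) else 0).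
rewrite (eq_bigr (fun j : 'I_r => peval (@mpolyC N (residue_field p)) (fun l => Psi_at Psi p (t l)) d
    (map_mpoly (to_residue p) (Q j)) * Psi_at Psi p (e j))); last first.
  by move=> j _; rewrite ltn_ord.
rewrite -WE Wp => /(_ _ erefl j0 j0r); rewrite j0r; apply => j m Dm.
case: ifP => jr; last by rewrite mcoeff0.
rewrite mcoeff_map_mpoly memN_msupp_eq0 ?raddf0 //; apply: msize_mdeg_ge.
by apply: leq_trans Dm; apply: (leq_bigmax (Ordinal jr)).
Qed.
End Relations.

(** * Evaluation at commuting matrices *)

Section MatrixEvaluation.
Variables (F K : fieldType) (i : {rmorphism F -> K}) (n s : nat).
Variable X : 'I_n -> 'M[K]_s.+1.

(** Products of polynomials are respected because the matrices [X l] are assumed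
    to commute; the order of the factors in a monomial is that of the indices. *)
Definition mxeval (P : {mpoly F[n]}) : 'M[K]_s.+1 := mmap (scalar_mx \o i) X P.

Hypothesis Xcomm : forall l m, X l * X m = X m * X l.

Lemma mxevalM : {morph mxeval : P Q / P * Q}.
Proof.
have XD m1 m2 : mmap1 X (m1 + m2)%MM = mmap1 X m1 * mmap1 X m2.
  rewrite /mmap1 -prodrM_comm; last by move=> l l' _ _; apply/commrX/commr_sym/commrX.
  by apply: eq_bigr => l _; rewrite mnmDE exprD.
move=> P Q.
have PQ : P * Q = \sum_(m1 <- msupp P) \sum_(m2 <- msupp Q) (P@_m1 * Q@_m2) *: 'X_[m1 + m2].
  rewrite {1}(mpolyE P) {1}(mpolyE Q) big_distrlr /=; apply: eq_bigr => m1 _.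
  by apply: eq_bigr => m2 _; rewrite -scalerAl -scalerAr scalerA -mpolyXD.
rewrite PQ /mxeval raddf_sum [X in _ = X * _]/mmap [X in _ = _ * X]/mmap big_distrlr /=.
apply: eq_bigr => m1 _; rewrite raddf_sum; apply: eq_bigr => m2 _ /=.
rewrite mmapZ mmapX XD rmorphM /=.
rewrite -!mulrA; congr (_ * _); rewrite !mulrA; congr (_ * _).
exact/esym/scalar_mxC.
Qed.

Lemma mxeval_rmorphism : exists f : {rmorphism {mpoly F[n]} -> 'M[K]_s.+1}, f =1 mxeval.
Proof.
have fB : zmod_morphism mxeval by exact: raddfB.
have fM : monoid_morphism mxeval.
  by split; [rewrite /mxeval mmapC /= rmorph1|exact: mxevalM].
pose f : {rmorphism {mpoly F[n]} -> 'M[K]_s.+1} := HB.pack mxeval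
  (GRing.isZmodMorphism.Build _ _ mxeval fB) (GRing.isMonoidMorphism.Build _ _ mxeval fM).
by exists f.
Qed.

Lemma mxeval_peval d (g : nat -> {mpoly F[n]}) (T : nat -> K) (P : {mpoly F[d]}) :
  (forall l, (l < d)%N -> mxeval (g l) = (T l)%:M) ->
  mxeval (peval (@mpolyC n F) g d P) = (peval i T d P)%:M.
Proof.
have [f fE] := mxeval_rmorphism; move=> gT.
rewrite -fE rmorph_sum rmorph_sum; apply: eq_bigr => m _.
rewrite rmorphM [in RHS]rmorphM; congr (_ * _); first by rewrite fE /mxeval mmapC.
rewrite !rmorph_prod; apply: eq_bigr => l _; rewrite !rmorphXn; congr (_ ^+ _).
by rewrite fE gT.
Qed.

(** Apply a relation sum_j P_j(g) h_j = 0 to the row vector v: since g_l acts as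
    the scalar T_l and v h_j is the j-th basis vector, the j-th coordinate of the
    result is P_j(T). The T_l are algebraically independent, so P_j = 0. *)
Lemma matrix_certificate d (g : nat -> {mpoly F[n]}) r (h : nat -> {mpoly F[n]})
    (T : nat -> K) (v : 'rV[K]_s.+1) :
  (r <= s.+1)%N ->
  (forall P : {mpoly F[d]}, peval i T d P = 0 -> P = 0) ->
  (forall l, (l < d)%N -> mxeval (g l) = (T l)%:M) ->
  (forall j, (j < r)%N -> v *m mxeval (h j) = delta_mx 0 (inord j)) ->
  lin_indep (peval (@mpolyC n F) g d) r h.
Proof.
move=> rs Tindep gT hv P P0 j jr; apply: Tindep.
have [f fE] := mxeval_rmorphism.
have : v *m f (\sum_(j < r) peval (@mpolyC n F) g d (P j) * h j) = 0.
  by rewrite P0 rmorph0 mulmx0.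
rewrite rmorph_sum mulmx_sumr => /(congr1 (fun u : 'rV_s.+1 => u 0 (inord j))).
rewrite mxE summxE (bigD1 (Ordinal jr)) //= big1 ?addr0.
  rewrite rmorphM /= !fE (mxeval_peval _ gT) -[_ * _]/(_ *m _) mulmxA.
  rewrite scalar_mxC -mulmxA hv // mul_scalar_mx !mxE !eqxx mulr1.
  by [].
move=> j' /negbTE jj'; rewrite rmorphM /= !fE (mxeval_peval _ gT) -[_ * _]/(_ *m _) mulmxA.
rewrite scalar_mxC -mulmxA hv // mul_scalar_mx !mxE /= -(inj_eq val_inj) /=.
rewrite !inordK ?(leq_trans jr) //; last exact: leq_trans (ltn_ord j') rs.
by rewrite eq_sym -[j]/(val (Ordinal jr)) (inj_eq val_inj) jj' mulr0.
Qed.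
End MatrixEvaluation.

Lemma mxeval_map (A : comNzRingType) (F K : fieldType) (f : {rmorphism A -> F})
    (i : {rmorphism F -> K}) n s (X : 'I_n -> 'M[K]_s.+1) (P : {mpoly A[n]}) :
  mxeval i X (map_mpoly f P) =
  \sum_(m <- msupp P) (i (f P@_m))%:M * \prod_l X l ^+ m l.
Proof.
have -> : map_mpoly f P = \sum_(m <- msupp P) f P@_m *: 'X_[m].
  rewrite {1}(mpolyE P) raddf_sum; apply: eq_bigr => m _.
  by rewrite /= map_mpolyZ map_mpolyX.
rewrite /mxeval raddf_sum; apply: eq_bigr => m _.
by rewrite /= mmapZ mmapX.
Qed.

(** * Lifting fractions to nearby primes *)

Section NearFractions.
Variables (R : idomainType) (U : set_system (Spec R)) (q : Spec R).
Hypotheses (FU : Filter U) (Uq : spec_limit U q).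
Variable n : nat.

Local Notation ffield p := {fraction {mpoly (residue_field p)[n]}}.

Definition reduce (p : Spec R) (W : {mpoly R[n]}) : ffield p :=
  (map_mpoly (to_residue p) W)%:F.
Arguments reduce : simpl never.

HB.instance Definition _ (p : Spec R) := GRing.RMorphism.copy (reduce p)
  (@FracField.tofrac {mpoly (residue_field p)[n]} \o map_mpoly (to_residue p)).

Lemma reduce_eq0 p W : (reduce p W == 0) = (map_mpoly (to_residue p) W == 0).
Proof. exact: tofrac_eq0. Qed.

Lemma near_reduce_neq0 W : reduce q W != 0 -> U [set p | reduce p W != 0].
Proof.
rewrite reduce_eq0 => /(near_map_mpoly_neq0 FU Uq); apply: filterS => p /=.
by rewrite reduce_eq0.
Qed.

(** The family y lifts x to the primes near q: a single quotient of polynomials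
    over R reduces to x at q and to y p at almost all p. This is the graph of the
    embedding of the field at q in the ultraproduct of the fields at the p. *)
Definition near_lift (x : ffield q) (y : forall p, ffield p) : Prop :=
  exists a c, [/\ reduce q c != 0, x = reduce q a / reduce q c &
    U [set p | y p = reduce p a / reduce p c]].

Lemma eq_near_lift x x' y y' : x = x' -> (forall p, y p = y' p) ->
  near_lift x y -> near_lift x' y'.
Proof.
move=> <- yy' [a [c [c0 e yU]]]; exists a, c; split; [exact: c0|exact: e|].
by apply: filterS yU => p; rewrite /mkset yy'.
Qed.

Lemma near_lift_exists x : exists y, near_lift x y.
Proof.
have [a [c [c0 ->]]] := fracE x.
have [s sq [a' a'E]] := lift_residue_mpoly a.
have [s' s'q [c' c'E]] := lift_residue_mpoly c.
have s0 := to_residue_neq0 sq; have s'0 := to_residue_neq0 s'q.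
have C0 z : z != 0 -> (z%:MP_[n])%:F != 0 :> ffield q by rewrite tofrac_eq0 mpolyC_eq0.
pose a2 : {mpoly R[n]} := s'%:MP * a'; pose c2 : {mpoly R[n]} := s%:MP * c'.
have aE : reduce q a2 = ((to_residue q s')%:MP)%:F * ((to_residue q s)%:MP)%:F * a%:F.
  by rewrite /reduce rmorphM /= map_mpolyC -a'E -mul_mpolyC !rmorphM mulrA.
have cE : reduce q c2 = ((to_residue q s')%:MP)%:F * ((to_residue q s)%:MP)%:F * c%:F.
  by rewrite /reduce rmorphM /= map_mpolyC -c'E -mul_mpolyC !rmorphM mulrA [X in X * _]mulrC.
exists (fun p => reduce p a2 / reduce p c2), a2, c2.
split.
- rewrite cE; apply: mulf_neq0; last by rewrite tofrac_eq0.
  exact: mulf_neq0 (C0 _ s'0) (C0 _ s0).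
- by rewrite aE cE -mulf_div divff ?mul1r //; exact: mulf_neq0 (C0 _ s'0) (C0 _ s0).
- by apply: filterS filterT.
Qed.

Lemma near_lift_reduce W : near_lift (reduce q W) (fun p => reduce p W).
Proof.
exists W, 1; split; first by rewrite rmorph1 oner_neq0.
  by rewrite rmorph1 divr1.
by apply: filterS filterT => p _ /=; rewrite -[X in _ / X]/(reduce p 1) rmorph1 divr1.
Qed.

Lemma near_liftB x x' y y' : near_lift x y -> near_lift x' y' ->
  near_lift (x - x') (fun p => y p - y' p).
Proof.
case=> a [c [c0 -> yU]] [a' [c' [c'0 -> y'U]]].
exists (a * c' - a' * c), (c * c'); split; first by rewrite rmorphM; exact: mulf_neq0 c0 c'0.
  by rewrite -[- (reduce q a' / _)]mulNr (addf_div _ _ c0 c'0) mulNr rmorphB !rmorphM.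
apply: filterS (filterI (filterI yU y'U) (filterI (near_reduce_neq0 c0) (near_reduce_neq0 c'0))).
move=> p [[/= -> ->] [/= pc pc']].
by rewrite -[- (reduce p a' / _)]mulNr (addf_div _ _ pc pc') mulNr rmorphB !rmorphM.
Qed.

Lemma near_lift0 : near_lift 0 (fun p => 0).
Proof.
exact: eq_near_lift (rmorph0 (reduce q)) (fun p => rmorph0 (reduce p)) (near_lift_reduce 0).
Qed.

Lemma near_liftD x x' y y' : near_lift x y -> near_lift x' y' ->
  near_lift (x + x') (fun p => y p + y' p).
Proof.
move=> xy x'y'; apply: eq_near_lift (near_liftB xy (near_liftB near_lift0 x'y')) => [|p].
  by rewrite sub0r opprK.
by rewrite sub0r opprK.
Qed.

Lemma near_liftM x x' y y' : near_lift x y -> near_lift x' y' ->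
  near_lift (x * x') (fun p => y p * y' p).
Proof.
case=> a [c [c0 -> yU]] [a' [c' [c'0 -> y'U]]].
exists (a * a'), (c * c'); split; first by rewrite rmorphM; exact: mulf_neq0 c0 c'0.
  by rewrite mulf_div !rmorphM.
apply: filterS (filterI yU y'U) => p [/= -> ->].
by rewrite mulf_div !rmorphM.
Qed.

(** A numerator that vanishes at q has all its coefficients in q, hence vanishes
    at almost all p. *)
Lemma near_lift_eq x y y' : near_lift x y -> near_lift x y' -> U [set p | y p = y' p].
Proof.
move=> xy xy'; have [a [c [c0 e yU]]] := near_liftB xy xy'.
have a0 : map_mpoly (to_residue q) a = 0.
  rewrite (subrr x) in e; apply/eqP; rewrite -reduce_eq0; apply/eqP.
  by rewrite -[LHS](divfK c0) -e mul0r.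
apply: filterS (filterI yU (near_map_mpoly_eq0 FU Uq a0)) => p [/= e' ap].
by apply/eqP; rewrite -subr_eq0 e' /reduce ap rmorph0 mul0r.
Qed.

Lemma near_lift_sum (I : Type) (s : seq I) (x : I -> ffield q) (y : I -> forall p, ffield p) :
  (forall i, near_lift (x i) (y i)) ->
  near_lift (\sum_(i <- s) x i) (fun p => \sum_(i <- s) y i p).
Proof.
move=> xy; elim: s => [|i s IH].
  by apply: eq_near_lift near_lift0 => [|p]; rewrite big_nil.
by apply: eq_near_lift (near_liftD (xy i) IH) => [|p]; rewrite big_cons.
Qed.
End NearFractions.

(** * Matrix certificates of independence *)

Definition const_frac (F : fieldType) (n : nat) : {rmorphism F -> {fraction {mpoly F[n]}}} :=
  @FracField.tofrac {mpoly F[n]} \o @mpolyC n F.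

(** The l-th variable as a fraction, and 0 when there is no such variable; with
    nat indices it can be the point of [peval]. *)
Definition frac_var (F : fieldType) (n : nat) (l : nat) : {fraction {mpoly F[n]}} :=
  (if insub l is Some l' then 'X_l' : {mpoly F[n]} else 0)%:F.

(** The inclusion of the polynomials in d variables in those in n variables has a
    retraction, which sends the additional variables to 0. *)
Lemma frac_var_indep (F : fieldType) (d n : nat) (P : {mpoly F[d]}) :
  (d <= n)%N -> peval (const_frac F n) (@frac_var F n) d P = 0 -> P = 0.
Proof.
move=> dn P0; pose x l : {mpoly F[n]} := if insub l is Some l' then 'X_l' else 0.
pose y l : {mpoly F[d]} := if insub l is Some l' then 'X_l' else 0.
have E : peval (@mpolyC n F) x d P = 0.
  by apply/eqP; rewrite -tofrac_eq0 [X in X == 0]peval_rmorph; apply/eqP.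
have := peval_rmorph (@mpolyC n F) (peval (@mpolyC d F) y n) x P.
rewrite E rmorph0 => /esym.
rewrite (eq_peval_coef (j := @mpolyC d F)); last by move=> c; apply: pevalC.
rewrite (@eq_peval _ _ _ _ y); last first.
  move=> l ld /=; have ln := leq_trans ld dn.
  by rewrite /x (insubT (fun l => l < n)%N ln) pevalX.
move=> <-; rewrite [in LHS](mpolyE P); apply: eq_bigr => m _.
rewrite mul_mpolyC mpolyXE_id; congr (_ *: _); apply: eq_bigr => l _.
by rewrite /y valK.
Qed.

(** [X l] is the matrix of the multiplication by the l-th variable in the basis
    [w], and [v] consists of the coordinates of 1. All three identities hold because
    the two sides act in the same way on the fraction field of the polynomial ring. *)
Lemma multiplication_matrices (F : fieldType) (N n : nat) (G : nat -> {mpoly F[N]})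
    (s : nat) (w : nat -> {mpoly F[N]}) iota :
  @frac_basis F {mpoly F[N]} (@mpolyC N F) n G s.+1 w iota ->
  exists (X : 'I_N -> 'M[{fraction {mpoly F[n]}}]_s.+1) (v : 'rV_s.+1),
  [/\ forall l m, X l * X m = X m * X l,
      forall l, (l < n)%N -> mxeval (const_frac F n) X (G l) = (@frac_var F n l)%:M &
      forall j, (j < s.+1)%N ->
        v *m mxeval (const_frac F n) X (w j) = delta_mx 0 (inord j)].
Proof.
case=> iE ind span _.
(* phi sends coordinates to elements of the fraction field. *)
pose phi (u : 'rV[{fraction {mpoly F[n]}}]_s.+1) := \sum_(j < s.+1) iota (u 0 j) * (w j)%:F.
have phiD : {morph phi : u u' / u + u'}.
  by move=> u u'; rewrite -big_split; apply: eq_bigr => j _; rewrite mxE rmorphD mulrDl.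
have phiZ a u : phi (a *: u) = iota a * phi u.
  by rewrite mulr_sumr; apply: eq_bigr => j _; rewrite mxE rmorphM mulrA.
have phi0 : phi 0 = 0 by rewrite -(scale0r 0) phiZ rmorph0 mul0r.
have phi_inj u u' : phi u = phi u' -> u = u'.
  move=> e; apply/eqP; rewrite -subr_eq0; apply/eqP/rowP => j; rewrite [RHS]mxE.
  have : phi (u - u') = 0.
    by rewrite -scaleN1r phiD phiZ e rmorphN rmorph1 mulN1r subrr.
  move=> E; have := ind (fun l => (u - u') 0 (inord l)).
  rewrite -[X in _ = X -> _]E => /(_ _ j (ltn_ord j)); rewrite inord_val; apply.
  by apply: eq_bigr => l _; rewrite inord_val.
have phi_surj b : exists u, phi u = b%:F.
  have [a ->] := span b; exists (\row_j a j).
  by apply: eq_bigr => j _; rewrite mxE.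
have phi_delta (j : 'I_s.+1) : phi (delta_mx 0 j) = (w j)%:F.
  rewrite /phi (bigD1 j) //= mxE !eqxx rmorph1 mul1r big1 ?addr0 // => l /negbTE lj.
  by rewrite mxE lj andbF rmorph0 mul0r.
pose acts (A : 'M_s.+1) (b : {fraction {mpoly F[N]}}) := forall u, phi (u *m A) = b * phi u.
have acts_eq A A' b : acts A b -> acts A' b -> A = A'.
  move=> hA hA'; apply/row_matrixP => i.
  by rewrite !rowE; apply: phi_inj; rewrite hA hA'.
have actsM A A' b b' : acts A b -> acts A' b' -> acts (A * A') (b * b').
  by move=> hA hA' u; rewrite mulmxA hA' hA mulrA [b' * b]mulrC.
have acts_scalar a : acts a%:M (iota a) by move=> u; rewrite mul_mx_scalar phiZ.
have /choice[row rowP] : forall lj : 'I_N * 'I_s.+1, exists u, phi u = ('X_lj.1 * w lj.2)%:F.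
  by move=> lj; apply: phi_surj.
pose X l := \matrix_(j < s.+1) row (l, j).
have actsX l : acts (X l) ('X_l)%:F.
  move=> u; rewrite mulmx_sum_row (big_morph phi phiD phi0) mulr_sumr.
  by apply: eq_bigr => j _; rewrite phiZ rowK rowP rmorphM /= mulrCA.
have acts_eval P : acts (mxeval (const_frac F n) X P) P%:F.
  have -> : P%:F = \sum_(m <- msupp P) ((P@_m)%:MP)%:F * \prod_l ('X_l)%:F ^+ m l.
    rewrite {1}(mpolyE P) rmorph_sum; apply: eq_bigr => m _.
    rewrite -mul_mpolyC rmorphM; congr (_ * _); rewrite mpolyXE_id rmorph_prod.
    by apply: eq_bigr => l _; rewrite rmorphXn.
  rewrite /mxeval /mmap; apply: (big_ind2 acts) => [u|A b A' b' hA hA' u|m _].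
  - by rewrite mulmx0 phi0 mul0r.
  - by rewrite mulmxDr phiD hA hA' mulrDl.
  apply: (actsM).
    have := acts_scalar (const_frac F n P@_m); congr (acts _ _).
    by rewrite [LHS]iE; congr (_%:F); apply: pevalC.
  rewrite /mmap1; apply: (big_ind2 acts) => [u|A b A' b'|l _].
  - by rewrite mulmx1 mul1r.
  - exact: (actsM).
  elim: (m l) => [|t IH]; first by rewrite !expr0 => u; rewrite mulmx1 mul1r.
  by rewrite !exprS; apply: (actsM).
have [v vE] := phi_surj 1.
exists X, v; split.
- move=> l m; apply: (acts_eq _ _ (('X_l)%:F * ('X_m)%:F)); first exact: (actsM).
  by rewrite mulrC; apply: (actsM).
- move=> l ln; apply: acts_eq (acts_eval _) _.
  have := acts_scalar (@frac_var F n l); congr (acts _ _).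
  rewrite [LHS]iE; congr (_%:F).
  by rewrite /frac_var (insubT (fun l => l < n)%N ln) pevalX.
- move=> j js; apply: phi_inj; rewrite acts_eval vE rmorph1 mulr1.
  by rewrite phi_delta inordK.
Qed.

Section Certificate.
Variables (F : fieldType) (B : idomainType) (N : nat) (phi : B -> {mpoly F[N]}).
Variables (d : nat) (t : nat -> B) (r : nat) (e : nat -> B).

(** The first d variables T_l of the field of entries stand for the images of the
    t_l; the remaining ones leave room for a larger transcendence basis. *)
Definition certificate (n s : nat) (X : 'I_N -> 'M[{fraction {mpoly F[n]}}]_s.+1)
    (v : 'rV[{fraction {mpoly F[n]}}]_s.+1) : Prop :=
  [/\ forall l m, X l * X m = X m * X l,
      forall l, (l < d)%N -> mxeval (const_frac F n) X (phi (t l)) = (@frac_var F n l)%:M &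
      forall j, (j < r)%N ->
        v *m mxeval (const_frac F n) X (phi (e j)) = delta_mx 0 (inord j)].

(** Elements algebraic over the t_l remain so over a larger transcendental family,
    so the independent images of the e_j are part of a basis of the fraction field of
    the polynomial ring, in which the variables act by multiplication. *)
Lemma certificate_exists : (0 < r)%N ->
  base_change_indep (@mpolyC N F) phi d t r e ->
  (forall b, algebraic_elt (peval (@mpolyC N F) (fun l => phi (t l)) d) (phi b)) ->
  exists n s, [/\ (d <= n)%N, (r <= s.+1)%N & exists X v, @certificate n s X v].
Proof.
move=> r0 ind alg.
have gen b : exists P, b = mmap (@mpolyC N F) (fun l => 'X_l) P.
  by exists b; rewrite mpoly_gen.
have [n [G [s [w [iota [dn Gg rs wh fb]]]]]] :=
  frac_basis_extension gen r0 ind (fun j _ => alg (e j)).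
case: s rs fb => [|s] rs fb; first by have := leq_trans r0 rs.
have [X [v [Xcomm Xg vw]]] := multiplication_matrices fb.
exists n, s; split=> //; exists X, v; split=> // [l ld|j jr].
  by rewrite -Gg // Xg //; apply: leq_trans dn.
by rewrite -wh // vw //; apply: leq_trans rs.
Qed.

Lemma certificate_indep n s X v : (d <= n)%N -> (r <= s.+1)%N ->
  @certificate n s X v -> base_change_indep (@mpolyC N F) phi d t r e.
Proof.
move=> dn rs [Xcomm Xg vw].
apply: (matrix_certificate Xcomm rs _ Xg vw) => P; exact: frac_var_indep.
Qed.
End Certificate.

(** * Lifting matrices to nearby primes *)

Section NearMatrices.
Variables (R : idomainType) (U : set_system (Spec R)) (q : Spec R).
Hypotheses (FU : Filter U) (Uq : spec_limit U q).
Variable n : nat.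
Local Notation ffield p := {fraction {mpoly (residue_field p)[n]}}.

Definition near_mx a b (M : 'M[ffield q]_(a, b)) (M' : forall p, 'M[ffield p]_(a, b)) : Prop :=
  forall i j, near_lift U (M i j) (fun p => M' p i j).

Lemma near_mx_exists a b (M : 'M[ffield q]_(a, b)) : exists M', near_mx M M'.
Proof.
have /choice[y yP] : forall ij : 'I_a * 'I_b, exists y, near_lift U (M ij.1 ij.2) y.
  by move=> ij; apply: near_lift_exists.
exists (fun p => \matrix_(i, j) y (i, j) p) => i j.
by apply: eq_near_lift (yP (i, j)) => // p; rewrite mxE.
Qed.

Lemma near_mx_mul a b c (M : 'M[ffield q]_(a, b)) (L : 'M[ffield q]_(b, c)) M' L' :
  near_mx M M' -> near_mx L L' -> near_mx (M *m L) (fun p => M' p *m L' p).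
Proof.
move=> MM LL i j.
apply: eq_near_lift (near_lift_sum FU Uq (index_enum 'I_b)
  (fun l => near_liftM FU (MM i l) (LL l j))) => [|p]; by rewrite mxE.
Qed.

Lemma near_mx_scalar a (x : ffield q) (y : forall p, ffield p) :
  near_lift U x y -> near_mx (x%:M : 'M_a) (fun p => (y p)%:M).
Proof.
move=> xy i j; have [ij|ij] := boolP (i == j).
  by apply: eq_near_lift xy => [|p]; rewrite mxE ij.
by apply: eq_near_lift (near_lift0 q FU n) => [|p]; rewrite mxE (negbTE ij).
Qed.

Lemma near_mx_delta a b i0 j0 :
  near_mx (delta_mx i0 j0 : 'M_(a, b)) (fun p => delta_mx i0 j0).
Proof.
move=> i j; have [ij|ij] := boolP ((i == i0) && (j == j0)).
  apply: eq_near_lift (near_lift_reduce q FU (1 : {mpoly R[n]})) => [|p]; rewrite mxE ij.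
    exact: rmorph1.
  exact: rmorph1.
by apply: eq_near_lift (near_lift0 q FU n) => [|p]; rewrite mxE (negbTE ij).
Qed.

Lemma near_mx_eq a b (M : 'M[ffield q]_(a, b)) M' L' :
  near_mx M M' -> near_mx M L' -> U [set p | M' p = L' p].
Proof.
move=> MM ML.
have := @filter_forall _ ('I_a * 'I_b)%type
  (fun ij => [set p | M' p ij.1 ij.2 = L' p ij.1 ij.2]) U FU.
move=> H; apply: filterS (H _) => [p /= Hp|ij].
  by apply/matrixP => i j; apply: (Hp (i, j)).
exact: (near_lift_eq FU Uq (MM _ _) (ML _ _)).
Qed.

(** The entries of a polynomial in matrices are sums of products of entries, and
    such expressions are compatible with [near_lift]. *)
Lemma near_mxeval N s (X : 'I_N -> 'M[ffield q]_s.+1) X' (W : {mpoly R[N]}) :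
  (forall l, near_mx (X l) (X' l)) ->
  near_mx (mxeval (const_frac (residue_field q) n) X (map_mpoly (to_residue q) W))
    (fun p => mxeval (const_frac (residue_field p) n) (fun l => X' l p)
       (map_mpoly (to_residue p) W)).
Proof.
move=> XX.
pose E p (Y : 'I_N -> 'M[ffield p]_s.+1) := \sum_(m <- msupp W)
  ((const_frac (residue_field p) n (to_residue p W@_m))%:M : 'M_s.+1) * \prod_l Y l ^+ m l.
have EE p Y : mxeval (const_frac (residue_field p) n) Y (map_mpoly (to_residue p) W) = E p Y.
  exact: mxeval_map.
have nearC m : near_mx ((const_frac (residue_field q) n (to_residue q W@_m))%:M : 'M_s.+1)
    (fun p => (const_frac (residue_field p) n (to_residue p W@_m))%:M).
  have redC p : reduce p (W@_m)%:MP = const_frac (residue_field p) n (to_residue p W@_m).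
    by rewrite /reduce map_mpolyC.
  apply: near_mx_scalar.
  exact: eq_near_lift (redC q) redC (near_lift_reduce q FU (W@_m)%:MP).
have nearM (M L : 'M[ffield q]_s.+1) M' L' : near_mx M M' -> near_mx L L' ->
    near_mx (M * L) (fun p => M' p * L' p) by apply: near_mx_mul.
have near1 : near_mx (1 : 'M[ffield q]_s.+1) (fun p => 1).
  apply: near_mx_scalar; apply: eq_near_lift (near_lift_reduce q FU (1 : {mpoly R[n]})) => [|p].
    exact: rmorph1.
  exact: rmorph1.
have nearX l t : near_mx (X l ^+ t) (fun p => X' l p ^+ t).
  elim: t => [|t IH]; first exact: near1.
  move=> i j; apply: eq_near_lift (nearM _ _ _ _ (XX l) IH i j) => [|p]; by rewrite exprS.
have nearP m (r : seq 'I_N) :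
    near_mx (\prod_(l <- r) X l ^+ m l) (fun p => \prod_(l <- r) X' l p ^+ m l).
  elim: r => [|l r IH] i j.
    by apply: eq_near_lift (near1 i j) => [|p]; rewrite big_nil.
  by apply: eq_near_lift (nearM _ _ _ _ (nearX l (m l)) IH i j) => [|p]; rewrite big_cons.
have nearE : near_mx (E q X) (fun p => E p (fun l => X' l p)).
  move=> i j; rewrite /E.
  apply: eq_near_lift (near_lift_sum FU Uq (msupp W)
     (fun m => nearM _ _ _ _ (nearC m) (nearP m _) i j)).
    exact: esym (summxE _ _ _ i j).
  by move=> p; exact: esym (summxE _ _ _ i j).
by move=> i j; apply: eq_near_lift (nearE i j) => [|p]; rewrite EE.
Qed.
End NearMatrices.

(** * Independence spreads *)

Lemma near_frac_var (R : idomainType) (U : set_system (Spec R)) (q : Spec R) n l :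
  Filter U -> near_lift U (@frac_var (residue_field q) n l)
    (fun p => @frac_var (residue_field p) n l).
Proof.
move=> FU; pose W : {mpoly R[n]} := if insub l is Some l' then 'X_l' else 0.
have E p : reduce p W = @frac_var (residue_field p) n l.
  rewrite /reduce /frac_var /W; case: insub => [l'|]; last by rewrite rmorph0.
  by rewrite map_mpolyX.
exact: eq_near_lift (E q) E (near_lift_reduce q FU W).
Qed.

(** Apply j to the coefficients of an equation over k; it stays nonzero because j
    is injective. *)
Lemma algebraic_elt_base_change (k F : fieldType) (B C : idomainType)
    (iB : {rmorphism k -> B}) (j : {rmorphism k -> F}) (iC : {rmorphism F -> C})
    (f : {rmorphism B -> C}) d (t : nat -> B) b :
  (forall c, f (iB c) = iC (j c)) ->
  algebraic_elt (peval iB t d) b -> algebraic_elt (peval iC (f \o t) d) (f b).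
Proof.
move=> fC [Q Q0 Qb]; exists (map_poly (map_mpoly j) Q).
  rewrite map_poly_eq0_id0 //; apply: contraNneq Q0 => /mpolyP E.
  rewrite -lead_coef_eq0; apply/eqP/mpolyP => m; rewrite mcoeff0.
  by have := E m; rewrite mcoeff_map_mpoly mcoeff0 => /eqP; rewrite fmorph_eq0 => /eqP.
rewrite -map_poly_comp /= (eq_map_poly (g := f \o peval iB t d)); last first.
  move=> P /=; rewrite peval_map peval_rmorph.
  by apply: eq_peval_coef => c /=.
by rewrite map_poly_comp /root horner_map /= (eqP Qb) rmorph0.
Qed.

Section Spread.
Variables (k : fieldType) (R B : idomainType).
Variables (iR : {rmorphism k -> R}) (iB : {rmorphism k -> B}).
Variables (N : nat) (Psi : {rmorphism B -> {mpoly R[N]}}).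
Hypothesis Psi_k : forall c : k, Psi (iB c) = (iR c)%:MP_[N].
Variables (d : nat) (t : nat -> B) (r : nat) (e : nat -> B).
Hypothesis basis : poly_basis iB d t r e.
Variables (U : set_system (Spec R)) (q : Spec R).
Hypotheses (FU : Filter U) (Uq : spec_limit U q).

(** A certificate at q consists of finitely many entries, and its defining
    identities are finitely many equations between [near_lift]s. *)
Lemma independence_spreads :
  @fiber_indep R B N Psi d t r e q -> U [set p | @fiber_indep R B N Psi d t r e p].
Proof.
move=> ind.
have alg b : algebraic_elt (peval (@mpolyC N (residue_field q)) (fun l => Psi_at Psi q (t l)) d)
    (Psi_at Psi q b).
  have Psi_kq c : Psi_at Psi q (iB c) = mpolyC N ((to_residue q \o iR) c).
    by rewrite /= Psi_k map_mpolyC.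
  exact: (@algebraic_elt_base_change k (residue_field q) B {mpoly (residue_field q)[N]}
    iB (to_residue q \o iR) (@mpolyC N _) (Psi_at Psi q) d t b Psi_kq
    (poly_basis_algebraic basis b)).
have [n [s [dn rs [X [v [Xcomm Xg vw]]]]]] :=
  certificate_exists (poly_basis_gt0 basis) ind alg.
have /choice[X' XX'] l := near_mx_exists FU (X l).
have [v' vv'] := near_mx_exists FU v.
pose ev p f := mxeval (const_frac (residue_field p) n) (fun l => X' l p) (Psi_at Psi p f).
have evP f : near_mx U (mxeval (const_frac (residue_field q) n) X (Psi_at Psi q f))
    (fun p => ev p f) by exact: near_mxeval.
have commU : U [set p | forall lm : 'I_N * 'I_N, X' lm.1 p * X' lm.2 p = X' lm.2 p * X' lm.1 p].
  apply: filter_forall => -[l m].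
  apply: (near_mx_eq FU Uq (M := X l *m X m)); first exact: near_mx_mul.
  by rewrite [X l *m X m]Xcomm; apply: near_mx_mul.
have gU : U [set p | forall l : 'I_d, ev p (t l) = (@frac_var (residue_field p) n l)%:M].
  apply: filter_forall => l; apply: (near_mx_eq FU Uq (evP (t l))).
  rewrite (Xg l (ltn_ord l)).
  by apply: near_mx_scalar => //; apply: near_frac_var.
have hU : U [set p | forall j : 'I_r, v' p *m ev p (e j) = delta_mx 0 (inord j)].
  apply: filter_forall => j.
  apply: (near_mx_eq FU Uq (near_mx_mul FU Uq vv' (evP (e j)))).
  rewrite (vw j (ltn_ord j)).
  exact: near_mx_delta.
apply: filterS (filterI commU (filterI gU hU)) => p [/= cp [gp hp]].
apply: (@certificate_indep (residue_field p) B N (Psi_at Psi p) d t r e n s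
  (fun l => X' l p) (v' p) dn rs); split.
- by move=> l m; apply: (cp (l, m)).
- by move=> l ld; apply: (gp (Ordinal ld)).
- by move=> j jr; apply: (hp (Ordinal jr)).
Qed.

End Spread.

(** * The locus is open *)

(** The sets of primes in [F] are nonempty and decreasing if the locus is none of
    the open sets [V D]. The limit of an ultrafilter finer than [F] can then be
    neither in the locus, by [independence_spreads], nor outside, by
    [dependence_spreads]. *)
Lemma inj_locus_open (k : fieldType) (R B : idomainType)
    (iR : {rmorphism k -> R}) (iB : {rmorphism k -> B})
    (fgB : finitely_generated iB)
    (N : nat) (Psi : {rmorphism B -> {mpoly R[N]}})
    (Psi_k : forall c : k, Psi (iB c) = (iR c)%:MP_[N]) :
  open (inj_locus iR iB Psi).
Proof.
have [d [t [r [e basis]]]] := poly_basis_exists fgB.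
set X := inj_locus iR iB Psi.
pose V D := @fiber_indep_below R B N Psi d t r e D.
have XE p : X p <-> @fiber_indep R B N Psi d t r e p.
  exact: inj_locusP.
have XV D : X `<=` V D by move=> p /XE; apply: base_change_indep_below_all.
have [[D VX]|noD] := pselect (exists D, V D `<=` X).
  have -> : X = V D by apply/seteqP; split=> //; apply: XV.
  exact: open_fiber_indep_below.
exfalso.
pose F : set_system (Spec R) := filter_from [set: nat] (fun D => V D `\` X).
have FF : ProperFilter F.
  apply: filter_from_proper.
    apply: filter_from_filter; first by exists 0.
    move=> D D' _ _; exists (maxn D D') => // p [Vp Xp].
    split; split=> //; apply: base_change_indep_below_le Vp; [exact: leq_maxl|exact: leq_maxr].
  move=> D _; apply: contrapT => H; apply: noD; exists D => p Vp.
  by apply: contrapT => Xp; apply: H; exists p.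
have [U [UU FU]] := ultraFilterLemma FF.
have [q Uq] := ultrafilter_spec_limit UU.
have FiU : Filter U by exact _.
have UV D : U (V D `\` X) by apply: FU; exists D.
have [Xq|/XE nXq] := pselect (X q).
  have := independence_spreads Psi_k basis FiU Uq (proj1 (XE q) Xq).
  move=> UX; apply: (@filter_not_empty _ U).
  by apply: filterS (filterI UX (UV 0%N)) => p [/= /XE Xp [_ nXp]].
have [D UD] := dependence_spreads FiU Uq nXq.
apply: (@filter_not_empty _ U).
by apply: filterS (filterI UD (UV D)) => p [/= nVp [Vp _]].
Qed.

(** * Zariski's lemma *)

Lemma mulX_neqC (F : fieldType) d (z : {mpoly F[d]}) l c : z != 0 -> z * 'X_l != c%:MP.
Proof.
move=> z0; apply/eqP => /(congr1 (fun P => msize P)).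
have sX : msize ('X_l : {mpoly F[d]}) = 2%N by rewrite msizeX mdeg1.
have X0 : ('X_l : {mpoly F[d]}) != 0 by rewrite -msize_poly_eq0 sX.
rewrite (msizeM z0 X0) sX addn2 msizeC => e.
have : msize z != 0%N by rewrite msize_poly_eq0.
by case: (msize z) e => // s; case: (c != 0).
Qed.

(** Zariski's lemma. Take a [poly_basis] of K over k, with d transcendental
    elements t. If d = 0 every element is algebraic. If d > 0, finitely many
    products of generators and basis elements have a common denominator c0(t), so
    every element of K has a power of c0(t) as denominator. Let u be a nonzero
    coordinate of a power of c0(t) and f = 1 + c0 u T_0. Then the inverse of f(t)
    forces f to divide a power of c0 times u, hence u, as f is 1 modulo c0; so f
    divides f - c0 u T_0 = 1, which contradicts its positive degree. *)
Lemma fg_field_algebraic (k K : fieldType) (i : {rmorphism k -> K}) :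
  finitely_generated i -> forall x, integralOver i x.
Proof.
move=> fg x; have [d [t [r [e basis]]]] := poly_basis_exists fg.
have [r0 ind span alg] := basis.
have inj := lin_indep_inj r0 ind.
have [d0|d0] := posnP d.
  subst d; have [Q Q0 Qx] := alg x; apply/integral_algebraic.
  exists (map_poly (peval idfun (fun=> 0) 0) Q).
    rewrite map_poly_eq0_id0 //; apply: contraNneq Q0 => E.
    rewrite (mpoly0_const (lead_coef Q)) pevalC /= in E.
    by rewrite -lead_coef_eq0 (mpoly0_const (lead_coef Q)) E mpolyC0.
  rewrite -map_poly_comp (eq_map_poly (g := peval i t 0)) // => P /=.
  by rewrite (mpoly0_const P) !pevalC.
exfalso; have [n [y gen]] := fg.
pose M (b : K) := exists a : nat -> {mpoly k[d]}, b = \sum_(j < r) peval i t d (a j) * e j.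
have MD b b' : M b -> M b' -> M (b + b').
  move=> [a ->] [a' ->]; exists (fun j => a j + a' j).
  by rewrite -big_split; apply: eq_bigr => j _; rewrite rmorphD mulrDl.
have MZ c b : M b -> M (peval i t d c * b).
  move=> [a ->]; exists (fun j => c * a j).
  by rewrite mulr_sumr; apply: eq_bigr => j _; rewrite rmorphM mulrA.
have M0 : M 0 by exists (fun=> 0); rewrite big1 // => j _; rewrite rmorph0 mul0r.
(* The elements that get the common denominator: 1 and all products of a
   generator with a basis element. *)
pose z (l : option ('I_n * 'I_r)) := if l is Some (l, j) then y l * e j else 1.
have [c0 c00 c0P] : exists2 c, c != 0 & forall l, M (peval i t d c * z l).
  pose T : finType := option ('I_n * 'I_r).
  have [||s a b H s' ss'|s|c c0 cP] := @common_multiplier {mpoly k[d]} (fun c => c != 0)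
    (fun s c => forall s' : 'I_#|T|, val s' = s -> M (peval i t d c * z (enum_val s')))
    _ _ _ _ #|T|.
  - exact: oner_neq0.
  - exact: mulf_neq0.
  - by rewrite rmorphM -mulrA; apply: MZ; apply: H.
  - have [sT|sT] := boolP (s < #|T|)%N; last first.
      exists 1 => [|s' ss']; first exact: oner_neq0.
      by rewrite -ss' ltn_ord in sT.
    have [c [c0 [a ca]]] := span (z (enum_val (Ordinal sT))); exists c => // s' ss'.
    by rewrite (_ : s' = Ordinal sT); [exists a|apply: val_inj].
  exists c => // l; have := cP (enum_rank (l : T)) (ltn_ord _) _ erefl.
  by rewrite enum_rankK.
(* S is the set of elements with a power of c0 as denominator; it is closed
   under addition and multiplication by generators, hence is everything. *)
pose S b := exists m, M (peval i t d (c0 ^+ m) * b).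
have SD b b' : S b -> S b' -> S (b + b').
  move=> [m Hm] [m' Hm']; exists (m + m')%N; rewrite exprD mulrDr; apply: MD.
    rewrite rmorphM [X in M X](_ : _ = peval i t d (c0 ^+ m') * (peval i t d (c0 ^+ m) * b)).
      exact: MZ.
    by rewrite mulrAC mulrC.
  by rewrite rmorphM -mulrA; apply: MZ.
have Sy l b : S b -> S (y l * b).
  case=> m [a E]; exists m.+1.
  rewrite exprS rmorphM [X in M X](_ : _ = \sum_(j < r) peval i t d (a j) * (peval i t d c0 * (y l * e j))).
    elim/big_ind: _ => [//|//|j _]; apply: MZ; exact: (c0P (Some (l, j))).
  rewrite (_ : _ * _ = peval i t d c0 * y l * (peval i t d (c0 ^+ m) * b)); last by rewrite mulrACA.
  by rewrite E mulr_sumr; apply: eq_bigr => j _; rewrite mulrCA -mulrA.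
have Sall b : S b.
  have [P ->] := gen b; rewrite /mmap.
  elim/big_ind: _ => [|//|m _]; first by exists 0%N; rewrite mulr0.
  have S1 : S 1 by exists 1%N; apply: (c0P None).
  have Sm : S (mmap1 y m).
    rewrite -[mmap1 y m]mulr1 /mmap1.
    apply: (big_ind (fun w => forall b, S b -> S (w * b))) S1 => [b'|w w' Hw Hw' b'|l _].
    - by rewrite mul1r.
    - by move=> /Hw'/Hw; rewrite mulrA.
    - elim: (m l) => [|s IH] b' Sb; first by rewrite expr0 mul1r.
      by rewrite exprS -mulrA; apply: Sy; apply: IH.
  case: Sm => s Hs; exists s; rewrite mulrCA -(pevalC i t d); exact: MZ.
have [m0 [u uE]] := Sall 1.
have [j [jr uj0]] : exists j, (j < r)%N /\ u j != 0.
  apply: contrapT => H; have : peval i t d (c0 ^+ m0) * 1 == 0.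
    rewrite uE big1 // => j _; rewrite (_ : u j = 0) ?rmorph0 ?mul0r //.
    by apply/eqP; apply: contrapT => /negP uj; apply: H; exists j.
  by rewrite mulr1 raddf_eq0 // expf_eq0 (negbTE c00) andbF.
pose f := 1 + c0 * u j * 'X_(Ordinal d0).
have fC c : f != c%:MP.
  apply/eqP => fc; have /eqP := @mulX_neqC k d (c0 * u j) (Ordinal d0) (c - 1) (mulf_neq0 c00 uj0).
  by apply; rewrite rmorphB /= -fc /f rmorph1 addrC addKr.
have f0 : f != 0 by rewrite -mpolyC0.
have ef0 : peval i t d f != 0 by rewrite raddf_eq0.
have [m [a aE]] := Sall (peval i t d f)^-1.
have div : c0 ^+ m * u j = f * (c0 ^+ m0 * a j).
  apply/eqP; rewrite -subr_eq0; apply/eqP.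
  apply: (ind (fun j => c0 ^+ m * u j - f * (c0 ^+ m0 * a j))) jr.
  under eq_bigr => l _ do rewrite rmorphB !rmorphM mulrBl -!mulrA.
  rewrite sumrB -!mulr_sumr -uE -aE.
  rewrite mulr1 [X in _ - X]mulrCA [X in _ - _ * X]mulrCA divff // mulr1.
  by rewrite mulrC subrr.
(* f is 1 modulo c0, so it may be cancelled against powers of c0. *)
have fdvd s w w' : c0 ^+ s * w = f * w' -> exists w'', w = f * w''.
  elim: s w w' => [|s IH] w w'; first by rewrite expr0 mul1r; exists w'.
  rewrite exprS -mulrA mulrCA => E.
  have : c0 ^+ s * w = f * (c0 ^+ s * w - u j * 'X_(Ordinal d0) * w').
    rewrite mulrBr [X in _ - X]mulrCA -E /f mulrDl mul1r.
    rewrite [X in _ + X - _](_ : _ = u j * 'X_(Ordinal d0) * (c0 ^+ s * (c0 * w))) ?addrK //.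
    by rewrite -!mulrA mulrCA; congr (_ * _); rewrite mulrCA; congr (_ * _); rewrite mulrCA.
  exact: IH.
have [w uw] := fdvd _ _ _ div.
have f1 : f * (1 - c0 * w * 'X_(Ordinal d0)) = 1.
  have E : f * (c0 * w * 'X_(Ordinal d0)) = c0 * u j * 'X_(Ordinal d0).
    by rewrite uw -!mulrA mulrCA.
  by rewrite mulrBr mulr1 E /f addrK.
have : msize f = 1%N.
  have w0 : 1 - c0 * w * 'X_(Ordinal d0) != 0.
    by apply: contra_eq_neq f1 => ->; rewrite mulr0 eq_sym oner_neq0.
  have := congr1 (fun P => msize P) f1; rewrite msizeM // msize1.
  have := msize_poly_eq0 f; have := msize_poly_eq0 (1 - c0 * w * 'X_(Ordinal d0)).
  rewrite (negbTE f0) (negbTE w0); case: (msize f) => // [[|p]] //.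
  by case: (msize _) => // p' _ _ /=; rewrite addSn /= addnS.
by move/eqP/msize_poly1P => [c _ fc]; have := fC c; rewrite fc eqxx.
Qed.

(** * Algebraic base change and maximal ideals *)

Lemma maximal_inverse (R : comNzRingType) (m : Spec R) (s : R) :
  maximal_ideal m -> s \notin (m : {pred R}) ->
  exists u, 1 - s * u \in (m : {pred R}).
Proof.
(* The ideal generated by m and s. *)
move=> mmax sm; pose J : {pred R} := fun a => `[< exists u, a - s * u \in (m : {pred R}) >].
have [/asboolP//|J1] := boolP (1 \in J).
have JI : idealr_closed J.
  split=> //.
    by apply/asboolP; exists 0; rewrite mulr0 subr0 idealr0.
  move=> a x y /asboolP[u xu] /asboolP[v yv]; apply/asboolP; exists (a * u + v).
  have -> : a * x + y - s * (a * u + v) = a * (x - s * u) + (y - s * v).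
    by rewrite mulrDr mulrBr opprD [s * (a * u)]mulrCA addrACA.
  by rewrite rpredD // idealMr.
pose I : idealr R := HB.pack J (isIdealr.Build R J JI).
have mI : {subset (m : {pred R}) <= (I : {pred R})}.
  by move=> x xm; apply/asboolP; exists 0; rewrite mulr0 subr0.
case/negP: sm; apply: (mmax I mI); apply/asboolP; exists 1.
by rewrite mulr1 subrr idealr0.
Qed.

Lemma to_residue_surj (R : idomainType) (m : Spec R) :
  maximal_ideal m -> forall x : residue_field m, exists a, x = to_residue m a.
Proof.
move=> mmax x; have [a [s [sm ->]]] := residue_fracE x.
have [u su] := maximal_inverse mmax sm; exists (a * u).
rewrite rmorphM; congr (_ * _); apply: (mulfI (to_residue_neq0 sm)).
rewrite divff ?to_residue_neq0 // -rmorphM; apply/eqP.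
by rewrite -(rmorph1 (to_residue m)) -subr_eq0 -rmorphB to_residue_eq0.
Qed.

Lemma fg_residue_field (k : comNzRingType) (R : idomainType) (iR : {rmorphism k -> R}) (m : Spec R) :
  finitely_generated iR -> maximal_ideal m -> finitely_generated (to_residue m \o iR).
Proof.
case=> n [x gen] mmax; exists n, (fun l => to_residue m (x l)) => b.
have [a ->] := to_residue_surj mmax b; have [P ->] := gen a; exists P.
rewrite rmorph_sum; apply: eq_bigr => M _; rewrite rmorphM; congr (_ * _).
by rewrite rmorph_prod; apply: eq_bigr => l _; rewrite rmorphXn.
Qed.

Lemma horner_map_cons (A D : nzRingType) (g : {rmorphism A -> D}) p c z :
  (map_poly g (p * 'X + c%:P)).[z] = (map_poly g p).[z] * z + g c.
Proof. by rewrite rmorphD rmorphM /= map_polyX map_polyC hornerMXaddC. Qed.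

Section AlgebraicBaseChange.
Variables (k K : fieldType) (B C : idomainType).
Variables (iK : {rmorphism k -> K}) (iB : {rmorphism k -> B}).
Variables (iC : {rmorphism K -> C}) (phi : {rmorphism B -> C}).
Hypothesis phi_k : forall c : k, iC (iK c) = phi (iB c).

Lemma inj_of_tensor_lift_inj :
  injective (tensor_lift (iA := iK) (iB := iB) iC phi) -> injective phi.
Proof.
have [f fE] := tensor_lift_rmorphism phi_k.
move=> inj; apply: raddf_inj => b b0; apply: (@tens1_inj _ K _ iK iB).
apply: inj; rewrite -!fE raddf0 fE tensor_lift_tens // b0 mulr0 //.
Qed.

(** K (x) B is integral over B. Among the equations of a nonzero z in the kernel,
    divide by the unknown until the constant term b is nonzero, which the domain
    hypothesis allows. Applying the map to the equation gives phi b = 0. *)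
Lemma tensor_lift_inj_of_inj :
  (forall x, integralOver iK x) -> integral_domain (tensor iK iB) ->
  injective phi -> injective (tensor_lift (iA := iK) (iB := iB) iC phi).
Proof.
have [f fE] := tensor_lift_rmorphism phi_k.
move=> Kint [D1 Ddom] phi_inj; apply: (eq_inj _ fE); apply: raddf_inj => z fz.
(* Integrality is stated for nonzero rings, which the domain hypothesis provides. *)
pose D : comNzRingType := HB.pack (tensor iK iB)
  (GRing.PzSemiRing_isNonZero.Build (tensor iK iB) D1).
pose lB (b : B) : D := tens iK iB 1 b.
pose lK (x : K) : D := tens iK iB x 1.
have lBB : zmod_morphism lB by exact: tens_morphl.
have lBM : monoid_morphism lB.
  by split=> // b b'; rewrite /lB [RHS]tensM mulr1.
pose LB : {rmorphism B -> D} := HB.pack lB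
  (GRing.isZmodMorphism.Build _ _ lB lBB) (GRing.isMonoidMorphism.Build _ _ lB lBM).
have lKD x y : lK (x + y) = lK x + lK y by exact: tensDl.
have lKB : zmod_morphism lK.
  by move=> x y; apply: (addIr (lK y)); rewrite -lKD !subrK.
have lKM : monoid_morphism lK.
  by split=> // b b'; rewrite /lK [RHS]tensM mulr1.
pose LK : {rmorphism K -> D} := HB.pack lK
  (GRing.isZmodMorphism.Build _ _ lK lKB) (GRing.isMonoidMorphism.Build _ _ lK lKM).
have intK x : integralOver LB (LK x).
  have [q qmon qx] := Kint x; exists (map_poly iB q); first exact: monic_map.
  have -> : map_poly LB (map_poly iB q) = map_poly LK (map_poly iK q).
    rewrite -!map_poly_comp; apply: eq_map_poly => c /=.
    by rewrite /lK -[iK c]mul1r [RHS]tens_bal mulr1.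
  by rewrite /root horner_map (eqP qx) rmorph0.
have intz : integralOver LB (z : D).
  have [n [lam [b zE]]] := tensor_sum z.
  have -> : (z : D) = \sum_(j < n) LK (lam j) * LB (b j).
    rewrite zE; apply: eq_bigr => j _; by rewrite [RHS]tensM mulr1 mul1r.
  elim/big_ind: _ => [|x y|j _]; first exact: integral0.
    exact: integral_add.
  by apply: integral_mul; [exact: intK|exact: integral_id].
have [q qmon qz] := intz.
have {qmon} q0 : q != 0 by exact: monic_neq0.
apply: contrapT => /eqP z0.
elim/poly_ind: q q0 qz => [|p c IH]; first by rewrite eqxx.
rewrite /root (horner_map_cons LB p c z).
have [->|c0] := eqVneq c 0.
  rewrite addr0 mulf_eq0 rmorph0 addr0 => /norP[p0 _] /eqP pz.
  have [pz0|] := Ddom _ _ pz; first by apply: IH => //; apply/eqP.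
  by move/eqP; rewrite (negbTE z0).
move=> _ /eqP E; case/negP: c0; apply/eqP; apply: phi_inj; rewrite rmorph0.
have := congr1 f E; rewrite raddf0 rmorphD rmorphM fz mulr0 add0r => <-.
by rewrite fE tensor_lift_tens // rmorph1 mul1r.
Qed.
End AlgebraicBaseChange.

Theorem theorem1p7 (k : fieldType) (R B : idomainType)
    (iR : {rmorphism k -> R}) (iB : {rmorphism k -> B})
    (fgR : finitely_generated iR) (fgB : finitely_generated iB)
    (N : nat) (Psi : {rmorphism B -> {mpoly R[N]}})
    (Psi_k : forall c : k, Psi (iB c) = (iR c)%:MP_[N]) :
  constructible (inj_locus iR iB Psi) /\
  (geometrically_integral iB ->
   forall m : Spec R, maximal_ideal m ->
     (m \in inj_locus iR iB Psi <-> injective (Psi_at Psi m))).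
Proof.
split.
  (* The locus is open, so one locally closed set suffices. *)
  exists 1%N, (fun=> inj_locus iR iB Psi), (fun=> setT); split.
  - by move=> _; apply: inj_locus_open.
  - by move=> _; apply: closedT.
  - by rewrite setIT bigcup_const //; exists ord0.
move=> gint m mmax; rewrite inE.
have Psi_km c : @mpolyC N _ ((to_residue m \o iR) c) = Psi_at Psi m (iB c).
  by rewrite /= Psi_k map_mpolyC.
split=> [inj|inj].
  exact: (inj_of_tensor_lift_inj Psi_km inj).
apply: (tensor_lift_inj_of_inj Psi_km _ (gint _ _) inj).
exact: (fg_field_algebraic (fg_residue_field fgR mmax)).
Qed.
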